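(* Let $m\geq 3$ be an odd integer. Then there exists $N_0$ depending only on $m$ such that for any integer $N\geq N_0$ and any real numbers $a_0,a_1,\dots,a_{m-1}$ with $a_k\leq 0$ for $1\leq k\leq m-1$, the radial solution $u$ of the initial value problem $$ \begin{cases} (-\Delta)^m u=e^u,\\ u^{(2k+1)}(0)=0 & \text{for all } 0\leq k\leq m-1,\\ \Delta^k u(0)=a_k & \text{for all } 0\leq k\leq m-1, \end{cases} $$ is stable in $\mathbb{R}^N$.
   Context: Radial functions on $\mathbb{R}^N$ are written $u(x)=u(r)$ with $r=|x|$, and the Laplacian acts on them by $\Delta u=r^{1-N}(r^{N-1}u')'$. The solution of the initial value problem is the smooth radial solution, considered on its maximal interval of existence; saying that it is stable in $\mathbb{R}^N$ means that it is defined on all of $\mathbb{R}^N$ and is stable there in the following sense. For $m$ odd, a solution $u$ of $(-\Delta)^m u=e^u$ in $\mathbb{R}^N$ is called stable in $\mathbb{R}^N$ if $$\int_{\mathbb{R}^N}|\nabla(\Delta^{\frac{m-1}{2}}\phi)|^2\,dx-\int_{\mathbb{R}^N}e^u\phi^2\,dx\geq 0\quad\text{for every }\phi\in C_0^\infty(\mathbb{R}^N).$$ *)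

(* Defs.v *)
From HB Require Import structures.
From mathcomp Require Import all_boot all_order all_algebra.
From mathcomp Require Import all_classical all_reals all_analysis.
Set Implicit Arguments.
Unset Strict Implicit.
Unset Printing Implicit Defensive.
Import Order.TTheory GRing.Theory Num.Theory.
Import numFieldNormedType.Exports.
Local Open Scope classical_set_scope.
Local Open Scope ring_scope.

(* Lebesgue measure on R^n, carried by n.-tuples (which have the product
   sigma-algebra), as the n-fold product of the one-dimensional one: R^(n+1) is
   identified with R x R^n by tuple_cons. *)
Section LebesgueMeasureRn.
Context {R : realType}.
Local Notation mR := (measurableTypeR R).

Definition tuple_cons n (p : mR * n.-tuple mR) : n.+1.-tuple mR :=
  [the n.+1.-tuple mR of p.1 :: p.2].

Lemma measurable_tuple_cons n : measurable_fun [set: mR * n.-tuple mR] (@tuple_cons n).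
Proof. by apply: measurable_cons. Qed.

Section step.
Variables (n : nat) (mu : {sigma_finite_measure set (n.-tuple mR) -> \bar R}).

Definition lebesgue_cons : set (n.+1.-tuple mR) -> \bar R :=
  pushforward (lebesgue_measure \x mu)%E (@tuple_cons n).

Let lebesgue_cons0 : lebesgue_cons set0 = 0%E.
Proof. by rewrite /lebesgue_cons /pushforward preimage_set0 measure0. Qed.

Let lebesgue_cons_ge0 A : (0 <= lebesgue_cons A)%E.
Proof. by rewrite /lebesgue_cons /pushforward measure_ge0. Qed.

Let lebesgue_cons_sigma_additive : semi_sigma_additive lebesgue_cons.
Proof.
pose m := measure_function_pushforward__canonical__measure_function_Measure
  (lebesgue_measure \x mu)%E (@measurable_tuple_cons n).
exact: (@measure_semi_sigma_additive _ _ _ m).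
Qed.

HB.instance Definition _ := isMeasure.Build _ _ _ lebesgue_cons
  lebesgue_cons0 lebesgue_cons_ge0 lebesgue_cons_sigma_additive.

Let lebesgue_cons_sigma_finite : sigma_finite setT lebesgue_cons.
Proof.
have /sigma_finiteP[F [FT ndF Foo]] := sigma_finiteT (@lebesgue_measure R).
have /sigma_finiteP[G [GT ndG Goo]] := sigma_finiteT mu.
pose g (t : n.+1.-tuple mR) : mR * n.-tuple mR := (thead t, [tuple of behead t]).
have mg : measurable_fun setT g.
  apply/measurable_fun_pairP; split => /=.
    exact: (@measurable_tnth _ _ _ ord0).
  exact: measurable_behead.
have gK : cancel (@tuple_cons n) g.
  by move=> [x t]; congr pair; apply/val_inj.
exists (fun i => g @^-1` (F i `*` G i)).
  apply/esym; rewrite -subTset => t _.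
  have [i _ Fi] : (\bigcup_i F i) (g t).1 by rewrite -FT.
  have [j _ Gj] : (\bigcup_j G j) (g t).2 by rewrite -GT.
  exists (maxn i j) => //; split.
    by move: Fi; exact/subsetPset/ndF/leq_maxl.
  by move: Gj; exact/subsetPset/ndG/leq_maxr.
move=> i; have [mF Fi] := Foo i; have [mG Gi] := Goo i; split.
  by rewrite -[X in measurable X]setTI; apply: mg => //; exact: measurableX.
rewrite /lebesgue_cons /pushforward.
rewrite [X in (_ X < _)%E](_ : _ = F i `*` G i).
  by rewrite product_measure1E// lte_mul_pinfty// ge0_fin_numE.
by apply/seteqP; split => p; rewrite /preimage /mkset gK.
Qed.

HB.instance Definition _ :=
  @Measure_isSigmaFinite.Build _ _ _ lebesgue_cons lebesgue_cons_sigma_finite.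

End step.

Fixpoint lebesgue_Rn n : {sigma_finite_measure set (n.-tuple mR) -> \bar R} :=
  if n is k.+1 then [the {sigma_finite_measure set _ -> \bar R} of
                     lebesgue_cons (lebesgue_Rn k)]
  else [the {sigma_finite_measure set _ -> \bar R} of dirac [tuple]].

(* Real-valued, hence 0 by convention on non-integrable functions; it is used
   below only on integrands that are continuous with compact support. *)
Definition integral_Rn n (f : 'rV[R]_n -> R) : R :=
  \int[lebesgue_Rn n]_t f (\row_i (tnth t i : R)).

End LebesgueMeasureRn.

Section Calculus.
Context {R : realType} {N : nat}.
Implicit Types (f : 'rV[R]_N -> R) (x : 'rV[R]_N).

(* The library norm `|x| on 'rV[R]_N is the max norm. *)
Definition enorm x : R := Num.sqrt (\sum_i x ord0 i ^+ 2).

Definition partial (i : 'I_N) f : 'rV[R]_N -> R := 'D_(delta_mx ord0 i) f.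

Definition gradient f x : 'rV[R]_N := \row_i partial i f x.

Definition laplacian f x : R := \sum_i partial i (partial i f) x.

(* C^oo on an open set A: all iterated partial derivatives exist and are
   differentiable at every point of A. *)
Definition smooth_on (A : set 'rV[R]_N) f :=
  forall (s : seq 'I_N) x, A x -> differentiable (foldr partial f s) x.

Definition test_function f :=
  smooth_on setT f /\ compact (closure [set x | f x != 0]).

(* (- Delta)^m *)
Definition neg_laplacian_iter m f : 'rV[R]_N -> R :=
  iter m (fun g x => - laplacian g x) f.

Definition stable m (u : 'rV[R]_N -> R) :=
  forall phi, test_function phi ->
    0 <= integral_Rn (fun x =>
           enorm (gradient (iter (m.-1)./2 laplacian phi) x) ^+ 2)
         - integral_Rn (fun x => expR (u x) * phi x ^+ 2).

End Calculus.

Section RadialSolution.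
Context {R : realType}.
Implicit Types (rho : \bar R) (u : R -> R).

Definition radial N u : 'rV[R]_N -> R := fun x => u (enorm x).

(* u : R -> R is the profile of a smooth radial solution in the ball of radius
   rho (all of R^N when rho = +oo). Only the values of u on [0, rho[ matter, so
   its derivatives at 0 are one-sided: the odd ones are taken as limits at 0+. *)
Record radial_solution m N (a : 'I_m -> R) rho u : Prop := {
  radius_gt0 : (0 < rho)%E ;
  smooth_solution : smooth_on [set x | (enorm x)%:E < rho]%E (radial (N:=N) u) ;
  equation : forall x : 'rV[R]_N, ((enorm x)%:E < rho)%E ->
    neg_laplacian_iter m (radial u) x = expR (radial u x) ;
  odd_derivatives0 : forall k, (k < m)%N ->
    derive1n (2 * k).+1 u r @[r --> 0^'+] --> 0 ;
  initial_values : forall k : 'I_m,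
    iter k laplacian (radial u) (0 : 'rV[R]_N) = a k }.

(* The maximal solution: every solution with the same initial values is a
   restriction of it. *)
Definition maximal_radial_solution m N (a : 'I_m -> R) rho u :=
  radial_solution N a rho u /\
  forall rho' v, radial_solution N a rho' v ->
    (rho' <= rho)%E /\ forall r, 0 <= r -> (r%:E < rho')%E -> v r = u r.

End RadialSolution.

(* Main.v *)
Require Import Defs.
From mathcomp Require Import all_boot all_order all_algebra.
From mathcomp Require Import all_classical all_reals all_analysis.
From mathcomp Require Import measurable_realfun ring lra zify.
Set Implicit Arguments.
Unset Strict Implicit.
Unset Printing Implicit Defensive.
Import Order.TTheory GRing.Theory Num.Theory.
Import numFieldNormedType.Exports.
Local Open Scope classical_set_scope.
Local Open Scope ring_scope.

(** The equation is solved as a cascade.  Write [N = k.+1].  Since [m] is odd,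
    the equation says that [u_0 = u], [u_(j+1) = Laplacian u_j] and
    [u_m = - e^u].  A radial function [w(|x|)] has Laplacian [G(|x|)] exactly
    when [w' = r v] and [(r^N v)' = r^(N-1) G], that is, when [v] is the
    weighted mean [average k G] of [G] and [w] is [inverse_laplacian k c G],
    where [c = w(0)].  So a solution is a fixed point of the map that sends [u]
    to the [m]-fold inverse Laplacian of [- e^u] with the prescribed values at
    [0] ([picard_map]).

    _Existence on the whole space._  The inverse Laplacian with a nonpositive
    initial value preserves nonpositivity.  As [a_k <= 0] for [k >= 1], all
    [u_j] with [j >= 1] are [<= 0], so every iterate is bounded above by
    [a_0], where the exponential is Lipschitz.  In the norm with weight
    [exp(- l r^2)] the inverse Laplacian is bounded by [1 / (2 l N)], hence
    the map is a contraction on the whole line once [l] is large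
    ([picard_fixpoint]).  The fixed point is smooth in the variable [r^2]
    because averaging commutes with [f |-> f' / r] up to a change of the
    weight ([average_deriv]); this makes [u(|x|)] smooth, including at the
    origin ([radial_smooth]).

    _Uniqueness._  Along an axis, the iterated Laplacians of any other
    solution satisfy the same flux equations ([competitor_flux]), and the same
    weighted estimate ([flux_exp_bound]) forces the difference to vanish
    ([radial_solution_unique]).

    _Decay._  On [[0, r]] one has [e^u >= e^(u(r))]; inserting this lower
    bound into the cascade gives [u' <= - C e^u r^(2m-1)], which integrates to
    [e^(-u(r)) >= e^(-a_0) + r^(2m) / Q^m] with [Q] linear in [N]
    ([picard_growth]).  Hence [e^u <= (2 Q)^m (|x|^2 + e)^(-m)] for a suitable
    [e > 0], and the constant is of order [N^m], independently of the data.

    _Stability._  For the smooth weights [(|x|^2 + e)^(-k)], completing squares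
    and discarding a divergence gives a Hardy inequality and Rellich
    inequalities with constant [(N / 4)^2] at every step ([hardy], [rellich]).
    Chained, they bound the quadratic form of the polyharmonic operator below
    by [(N / 4)^(m+1)] times the integral of [phi^2 (|x|^2 + e)^(-m)]
    ([hardy_rellich]).  The exponent [m + 1] beats the exponent [m] of the decay
    estimate, so the potential [e^u] is dominated as soon as [N] is large
    ([dimension_large]).  The integration by parts rests on the vanishing of
    the integral of a partial derivative, proved by Fubini and induction on the
    dimension ([integral_partial]). *)

(** * Derivatives and primitives on the real line *)

Section Deriv.
Context {R : realType} {V : normedModType R}.
Implicit Types (f g : V -> R) (x v : V).

Lemma is_derive_add f g x v (df dg : R) : is_derive x v f df ->
  is_derive x v g dg -> is_derive x v (fun y => f y + g y) (df + dg).
Proof. by move=> *; exact: is_deriveD. Qed.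

Lemma is_derive_sub f g x v (df dg : R) : is_derive x v f df ->
  is_derive x v g dg -> is_derive x v (fun y => f y - g y) (df - dg).
Proof. by move=> *; exact: is_deriveB. Qed.

Lemma is_derive_opp f x v (df : R) : is_derive x v f df ->
  is_derive x v (fun y => - f y) (- df).
Proof. by move=> *; exact: is_deriveN. Qed.

Lemma is_derive_mul f g x v (df dg : R) : is_derive x v f df ->
  is_derive x v g dg ->
  is_derive x v (fun y => f y * g y) (f x * dg + g x * df).
Proof. by move=> *; exact: is_deriveM. Qed.

Lemma is_derive_scale (k : R) f x v (df : R) : is_derive x v f df ->
  is_derive x v (fun y => k * f y) (k * df).
Proof. by move=> *; exact: is_deriveZ. Qed.

Lemma is_derive_pow f n x v (df : R) : is_derive x v f df ->
  is_derive x v (fun y => f y ^+ n) (n%:R * f x ^+ n.-1 * df).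
Proof.
move=> H; have := @is_deriveX _ _ f n x v df H.
rewrite (_ : f ^+ n = (fun y => f y ^+ n)) //.
by apply/funext => y; elim: n => [|n IH]; rewrite ?expr0 // !exprS /= -IH.
Qed.

Lemma is_derive_comp (h : R -> R) f x v (df dh : R) :
  is_derive (f x) 1 h dh -> differentiable f x -> is_derive x v f df ->
  is_derive x v (fun y => h (f y)) (dh * df).
Proof.
move=> Hh df' Hf.
have dh' : differentiable h (f x) by apply/derivable1_diffP; case: Hh.
have dc : differentiable (h \o f) x by apply: differentiable_comp.
have E : 'D_v (h \o f) x = dh * df.
  rewrite deriveE // diff_comp //=.
  rewrite -(deriveE _ df') derive_val.
  rewrite deriv1E; last exact/derivable1_diffP.
  by rewrite derive1E derive_val /GRing.scale /= mulrC.
by rewrite -E; apply/derivableP/diff_derivable.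
Qed.

End Deriv.

Section RealLine.
Context {R : realType}.
Implicit Types (f g F G H : R -> R).

Lemma is_derive_id1 (x : R) : is_derive x 1 (fun y : R => y) 1.
Proof. exact: is_derive_id. Qed.

Lemma is_derive_X n (x : R) : is_derive x 1 (fun y : R => y ^+ n) (n%:R * x ^+ n.-1).
Proof. by have := is_derive_pow n (is_derive_id1 x); rewrite mulr1. Qed.

Lemma is_derive_chain f g (x a b : R) : is_derive (g x) 1 f a ->
  is_derive x 1 g b -> is_derive x 1 (fun y => f (g y)) (a * b).
Proof. by move=> *; exact: is_derive1_comp. Qed.

Lemma is_derive_cont f (x d : R) : is_derive x 1 f d -> {for x, continuous f}.
Proof. by case=> /derivable1_diffP/differentiable_continuous. Qed.

Lemma deriv_cont f df : (forall x : R, is_derive x 1 f (df x)) -> continuous f.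
Proof. by move=> H x; exact: is_derive_cont. Qed.

(** Form of the mean value theorem used for all comparisons of functions
    through their derivatives. *)
Lemma le_increment f g df dg (a b : R) : a <= b ->
  {within `[a, b], continuous f} -> {within `[a, b], continuous g} ->
  (forall x : R, x \in `]a, b[%R -> is_derive x 1 f (df x)) ->
  (forall x : R, x \in `]a, b[%R -> is_derive x 1 g (dg x)) ->
  (forall x, x \in `]a, b[%R -> df x <= dg x) ->
  f b - f a <= g b - g a.
Proof.
rewrite le_eqVlt => /predU1P[<-|ab]; first by rewrite !subrr.
move=> cf cg Hf Hg le.
pose h x := g x - f x.
have [|||c cab E] := @MVT R h (fun x => dg x - df x) a b => //.
- by move=> x xab; apply: is_derive_sub; [exact: Hg|exact: Hf].
- by move=> x; apply: continuousB; [exact: cg|exact: cf].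
have : 0 <= h b - h a.
  by rewrite E mulr_ge0 // subr_ge0; [exact: le|exact: ltW].
rewrite /h; lra.
Qed.

Lemma cont_integrable G (a b : R) : continuous G ->
  lebesgue_measure.-integrable `[a, b] (EFin \o G).
Proof.
move=> cG; apply: continuous_compact_integrable.
  exact: segment_compact.
exact: continuous_subspaceT.
Qed.

(** The base point [- (|r| + 1)] lies strictly to the left of both [0] and
    [r], so that the fundamental theorem of calculus applies at every real [r],
    and not only to the right of a fixed base point. *)
Definition primitive G (r : R) : R :=
  \int[lebesgue_measure]_(t in `[- (`|r| + 1), r]) G t -
  \int[lebesgue_measure]_(t in `[- (`|r| + 1), 0]) G t.

(** Near a given point the moving base point may be frozen; this is what
    makes [primitive G] differentiable. *)
Lemma primitiveE G (M r : R) : continuous G -> `|r| + 1 <= M ->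
  primitive G r = \int[lebesgue_measure]_(t in `[- M, r]) G t -
    \int[lebesgue_measure]_(t in `[- M, 0]) G t.
Proof.
move=> cG rM; rewrite /primitive; set m := - (`|r| + 1).
have mr : m <= r by rewrite /m; have := ler_norm (- r); rewrite normrN; lra.
have m0 : m <= 0 by rewrite /m; have := normr_ge0 r; lra.
have Mm : - M <= m by rewrite /m; lra.
have key (c : R) : m <= c ->
   \int[lebesgue_measure]_(t in `[- M, c]) G t =
   \int[lebesgue_measure]_(t in `[- M, m]) G t +
   \int[lebesgue_measure]_(t in `[m, c]) G t.
  move=> mc.
  have := @Rintegral_itvB R G (BLeft (- M)) (BRight c) m (cont_integrable _ _ cG).
  rewrite !bnd_simp => /(_ Mm mc).
  rewrite Rintegral_itv_obnd_cbnd; first by move=> <-; rewrite addrC subrK.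
  by apply: integrableS (cont_integrable m c cG) => //; apply: subset_itvr;
    rewrite bnd_simp.
by rewrite (key r) // (key 0) //; lra.
Qed.

Lemma primitive0 G : primitive G 0 = 0.
Proof. by rewrite /primitive subrr. Qed.

Lemma primitive_deriv G (r : R) : continuous G -> is_derive r 1 (primitive G) (G r).
Proof.
move=> cG; pose M := `|r| + 2.
pose F x := \int[lebesgue_measure]_(t in `[- M, x]) G t -
    \int[lebesgue_measure]_(t in `[- M, 0]) G t.
have FE : \near r, F r = primitive G r.
  have : \forall x \near r, ball r 1 x by exact: nbhsx_ballx.
  apply: filterS => x; rewrite /ball /= => xr; rewrite /F -primitiveE //.
  have := ler_normD r (x - r); rewrite addrC subrK distrC /M; lra.
apply: (near_eq_is_derive FE).
have rM : - M < r by rewrite /M; have := ler_norm (- r); rewrite normrN; lra.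
have [||d1 d2] := @continuous_FTC1_closed R G (- M) r (r + 1) _ _ rM (cG r).
- lra.
- exact: cont_integrable.
rewrite -[G r]subr0; apply: is_derive_sub.
  by apply: DeriveDef => //; rewrite -derive1E.
Qed.

End RealLine.

(** * Weighted averages *)

Section Average.
Context {R : realType}.
Implicit Types (G H : R -> R) (k : nat).

(** Equals the integral of [s^k G(r s)] over [s] in [[0, 1]]; at [r = 0] this
    is [G 0 / k.+1].  With [k.+1] the dimension, [r * average k G r] is the
    derivative of the radial function with Laplacian [G]. *)
Definition average k G (r : R) : R :=
  if r == 0 then G 0 / k.+1%:R
  else primitive (fun t : R => t ^+ k * G t) r / r ^+ k.+1.

Lemma cont_X k : continuous (fun r : R => r ^+ k).
Proof. exact: exprn_continuous. Qed.

Lemma cont_XM k G : continuous G -> continuous (fun t : R => t ^+ k * G t).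
Proof. by move=> cG x; apply: cvgM; [exact: cont_X|exact: cG]. Qed.

Lemma average_pow k G r :
  r ^+ k.+1 * average k G r = primitive (fun t : R => t ^+ k * G t) r.
Proof.
rewrite /average; case: eqP => [->|/eqP r0].
  by rewrite primitive0 exprS !mul0r.
by rewrite mulrC divfK // expf_neq0.
Qed.

Lemma average_pow_deriv k G (r : R) : continuous G ->
  is_derive r 1 (fun t : R => t ^+ k.+1 * average k G t) (r ^+ k * G r).
Proof.
move=> cG; rewrite (_ : (fun t : R => _) = primitive (fun t : R => t ^+ k * G t)).
  exact/primitive_deriv/cont_XM.
by apply/funext => t; rewrite average_pow.
Qed.

(** Cauchy's mean value theorem for the primitive of [t^k G] against
    [t^(k+1)].  It handles both signs of [r] at once, and yields the continuity
    at [0], the sign and the growth of averages. *)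
Lemma average_mean k G (r : R) : continuous G ->
  exists2 c, `|c| <= `|r| & average k G r = G c / k.+1%:R.
Proof.
move=> cG; have [->|r0] := eqVneq r 0.
  by exists 0 => //; rewrite /average eqxx.
pose p := primitive (fun t : R => t ^+ k * G t).
(* The auxiliary function of Cauchy's mean value theorem, null at [0] and [r]. *)
pose h (t : R) := p t * r ^+ k.+1 - p r * t ^+ k.+1.
have dh (t : R) : is_derive t 1 h
    (r ^+ k.+1 * (t ^+ k * G t) - p r * (k.+1%:R * t ^+ k)).
  apply: is_derive_sub; last exact/is_derive_scale/is_derive_X.
  rewrite (_ : (fun y => _) = (fun y => r ^+ k.+1 * p y)); last first.
    by apply/funext => y; rewrite mulrC.
  exact/is_derive_scale/primitive_deriv/cont_XM.
have h0 : h 0 = 0 by rewrite /h {1}/p primitive0 expr0n /= mul0r mulr0 subr0.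
have hr : h r = 0 by rewrite /h mulrC subrr.
have [c [c0 cr] dhc] : exists2 c : R, c != 0 /\ `|c| <= `|r| &
    r ^+ k.+1 * (c ^+ k * G c) - p r * (k.+1%:R * c ^+ k) = 0.
  case: (ltrgtP r 0) r0 => // rlt _.
  - have [|c /[!in_itv] /andP[rc c0] /eqP] := MVT rlt (fun x _ => dh x).
      exact/continuous_subspaceT/deriv_cont.
    rewrite hr h0 subrr eq_sym mulf_eq0 => /orP[/eqP E|];
      last by rewrite sub0r oppr_eq0 lt_eqF.
    exists c => //; split; first by rewrite lt_eqF.
    by rewrite !ltr0_norm // lerN2 ltW.
  - have [|c /[!in_itv] /andP[c0 rc] /eqP] := MVT rlt (fun x _ => dh x).
      exact/continuous_subspaceT/deriv_cont.
    rewrite hr h0 subrr eq_sym mulf_eq0 => /orP[/eqP E|]; last by rewrite subr0 gt_eqF.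
    exists c => //; split; first by rewrite gt_eqF.
    by rewrite !gtr0_norm // ltW.
exists c => //; rewrite /average (negPf r0) -/p.
have ck : c ^+ k != 0 by rewrite expf_neq0.
have rk : r ^+ k.+1 != 0 by rewrite expf_neq0.
have E : p r * k.+1%:R = r ^+ k.+1 * G c.
  apply: (mulIf ck); move/eqP: dhc; rewrite subr_eq0 => /eqP dhc.
  by rewrite -!mulrA -dhc; congr (_ * _); rewrite mulrC.
apply/eqP; rewrite eqr_div // ?pnatr_eq0 //; apply/eqP.
by rewrite E mulrC.
Qed.

Lemma average_deriv_neq0 k G (r : R) : continuous G -> r != 0 ->
  is_derive r 1 (average k G) ((G r - k.+1%:R * average k G r) / r).
Proof.
move=> cG r0.
pose p := primitive (fun t : R => t ^+ k * G t).
have E : \near r, p r / r ^+ k.+1 = average k G r.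
  have : \forall x \near r, x != 0.
    by apply: open_nbhs_nbhs; split => //; exact: open_neq.
  by apply: filterS => x x0; rewrite /average (negPf x0).
apply: (near_eq_is_derive E).
have rk : r ^+ k.+1 != 0 by rewrite expf_neq0.
have := is_derive_mul (primitive_deriv r (@cont_XM k G cG)) (@is_deriveV R (fun
  y : R => y ^+ k.+1) r _ 1 rk (is_derive_X k.+1 r)).
move/is_derive_eq; apply.
rewrite -/p /= /average (negPf r0) -/p /GRing.scale /=.
have -> : r ^+ k.+1 = r * r ^+ k by rewrite exprS.
have rk' : r ^+ k != 0 by rewrite expf_neq0.
by field; rewrite ?r0 ?rk'.
Qed.

Lemma average_cont k G : continuous G -> continuous (average k G).
Proof.
move=> cG r; have [->|r0] := eqVneq r 0; last first.
  exact: is_derive_cont (average_deriv_neq0 k cG r0).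
have a0 : average k G 0 = G 0 / k.+1%:R by rewrite /average eqxx.
apply/cvgrPdist_lt => e e0.
have /cvgrPdist_lt/(_ e e0) := cG 0; rewrite /= => -[d d0 Hd].
exists d => //= x /= xd.
have [c cx ->] := average_mean k x cG; rewrite a0.
rewrite -mulrBl normrM normfV.
rewrite ltr_pdivrMr ?normr_gt0 ?pnatr_eq0 //.
apply: (@lt_le_trans _ _ e).
  by apply: Hd => /=; move: xd; rewrite !sub0r !normrN => /(le_lt_trans cx).
by rewrite normr_nat ler_peMr ?ler1n // ltW.
Qed.

(** Integration by parts.  It is also the radial form of the identity
    [N v + r v' = G] for [v = average k G], valid at [r = 0] as well. *)
Lemma average_ibp k G H (r : R) : continuous H ->
  (forall t : R, is_derive t 1 G (t * H t)) ->
  average k G r = (G r - r ^+ 2 * average k.+2 H r) / k.+1%:R.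
Proof.
move=> cH dG; have cG := deriv_cont dG.
have [->|r0] := eqVneq r 0.
  by rewrite /average eqxx expr0n /= mul0r subr0.
pose h (t : R) := k.+1%:R * (t ^+ k.+1 * average k G t) -
   (t ^+ k.+1 * G t - t ^+ k.+3 * average k.+2 H t).
have dh (t : R) : is_derive t 1 h 0.
  apply: is_derive_eq.
    apply: is_derive_sub.
      exact/is_derive_scale/average_pow_deriv.
    apply: is_derive_sub; last exact: average_pow_deriv.
    apply: is_derive_mul (dG t); exact: is_derive_X.
  by rewrite /= !exprS; ring.
have : h r = 0.
  rewrite (is_derive_0_is_cst r 0 dh) /h !exprS; ring.
rewrite /h => /eqP; rewrite subr_eq0 => /eqP E.
have rk : r ^+ k.+1 != 0 by rewrite expf_neq0.
apply: (mulfI rk); apply: (@mulfI _ k.+1%:R); first by rewrite pnatr_eq0.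
rewrite E mulrCA [k.+1%:R * _]mulrC divfK ?pnatr_eq0 // mulrBr mulrA -exprD.
by rewrite addn2.
Qed.

Lemma is_derive_sqrM_at0 (g : R -> R) : continuous g ->
  is_derive (0 : R) 1 (fun t : R => t ^+ 2 * g t) 0.
Proof.
move=> cg; apply/is_derive1_caratheodory; exists (fun t : R => t * g t); split.
- by move=> z; rewrite expr0n /= mul0r !subr0 expr2; ring.
- by apply: cvgM; [exact: cvg_id|exact: cg].
- by rewrite mul0r.
Qed.

(** Differentiating [s^k G(r s)] under the integral sign, when
    [G'(r) = r H(r)], produces [r s^(k+2) H(r s)]: the operator [f |-> f' / r]
    commutes with averaging, up to raising the weight by [2]. *)
Lemma average_deriv k G H (r : R) : continuous H ->
  (forall t : R, is_derive t 1 G (t * H t)) ->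
  is_derive r 1 (average k G) (r * average k.+2 H r).
Proof.
move=> cH dG; have cG := deriv_cont dG.
have -> : average k G = fun r => k.+1%:R^-1 * (G r - r ^+ 2 * average k.+2 H r).
  by apply/funext => t; rewrite (average_ibp k t cH dG) mulrC.
have [->|r0] := eqVneq r 0.
  apply: is_derive_eq.
    apply: is_derive_scale; apply: is_derive_sub.
    exact/is_derive_sqrM_at0/average_cont.
  by rewrite mul0r subr0 mul0r mulr0.
have d := is_derive_scale k.+1%:R^-1 (is_derive_sub (dG r)
  (is_derive_mul (is_derive_X 2 r) (average_deriv_neq0 k.+2 cH r0))).
apply: is_derive_eq d _; rewrite /= expr1; field.
by rewrite r0 addrC natr1 pnatr_eq0.
Qed.

End Average.

(** * The radial inverse Laplacian *)

Section GeometricLimit.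
Context {R : realType}.

(** Completeness for a weighted sup norm on the whole line: the factor [M] may
    grow at infinity, and its continuity makes the convergence locally uniform. *)
Lemma geometric_limit (u : nat -> R -> R) (M : R -> R) :
  (forall n, continuous (u n)) -> continuous M ->
  (forall n r, `|u n.+1 r - u n r| <= M r * 2^-1 ^+ n) ->
  exists2 v, continuous v & forall n r, `|v r - u n r| <= 2 * M r * 2^-1 ^+ n.
Proof.
move=> cu cM Hu.
have M0 r : 0 <= M r.
  by have := le_trans (normr_ge0 _) (Hu 0%N r); rewrite expr0 mulr1.
have half0 n : 0 <= (2^-1 : R) ^+ n by rewrite exprn_ge0 // invr_ge0.
(* Sum of the geometric series, in the form that passes through the induction. *)
have tail n p (r : R) : `|u (n + p)%N r - u n r| <= 2 * M r * 2^-1 ^+ n * (1 -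
  2^-1 ^+ p).
  elim: p => [|p IH]; first by rewrite addn0 !subrr normr0 mulr0.
  rewrite addnS.
  apply: (le_trans (ler_distD (u (n + p)%N r) _ _)).
  apply: (le_trans (lerD (Hu _ _) IH)).
  rewrite exprD exprS; set x := _ ^+ n; set y := _ ^+ p.
  rewrite le_eqVlt; apply/orP; left; apply/eqP; by field.
have cvgu (r : R) : cvgn (u ^~ r).
  have -> : u ^~ r = (fun n => u 0%N r + series (fun i => u i.+1 r - u i r) n).
    by apply/funext => n; rewrite seriesEnat /= telescope_sumr // addrC subrK.
  apply: is_cvgD; first exact: is_cvg_cst.
  apply: normed_cvg.
  apply: (@series_le_cvg _ _ (geometric (M r) 2^-1)) => //.
  - by move=> n; exact: normr_ge0.
  - by move=> n; rewrite /= mulr_ge0.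
  - by move=> n; exact: Hu.
  - apply: is_cvg_geometric_series.
    by rewrite ger0_norm ?invr_ge0 // invf_lt1 // ltr1n.
pose v r := limn (u ^~ r).
have vu n r : `|v r - u n r| <= 2 * M r * 2^-1 ^+ n.
  have cv : (fun p => `|u (p + n)%N r - u n r|) @ \oo --> `|v r - u n r|.
    apply: cvg_norm; apply: cvgB; last exact: cvg_cst.
    by have := cvgu r; rewrite -(cvg_shiftn n).
  apply: (cvgr_to_le cv); apply: nearW => p.
  rewrite addnC; apply: (le_trans (tail _ _ _)).
  apply: ler_piMr; first by rewrite !mulr_ge0.
  by rewrite lerBlDr lerDl.
exists v => // r; apply/cvgrPdist_lt => e e0.
have [n Hn] : exists n, 2 * (M r + 1) * 2^-1 ^+ n < e / 3.
  have e3 : 0 < e / 3 by rewrite divr_gt0.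
  have := @cvg_geometric R (2 * (M r + 1)) 2^-1.
  rewrite ger0_norm ?invr_ge0 // invf_lt1 // ltr1n => /(_ isT).
  move/cvgrPdist_lt/(_ _ e3) => [n _ /(_ n (leqnn n))] /=.
  rewrite sub0r normrN ger0_norm; first by exists n.
  by rewrite mulr_ge0 // mulr_ge0 // addr_ge0.
have nM : \forall t \near r, `|M r - M t| < 1 by move/cvgrPdist_lt: (cM r); apply.
have e3 : 0 < e / 3 by rewrite divr_gt0.
have nu : \forall t \near r, `|u n r - u n t| < e / 3 by move/cvgrPdist_lt: (cu
  n r); apply.
near=> t.
have Mt : `|M r - M t| < 1 by near: t.
have ut : `|u n r - u n t| < e / 3 by near: t.
have b1 := vu n r; have b2 := vu n t.
have b1' : 2 * M r * 2^-1 ^+ n <= 2 * (M r + 1) * 2^-1 ^+ n.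
  by apply: ler_wpM2r => //; rewrite ler_wpM2l // lerDl.
have b2' : 2 * M t * 2^-1 ^+ n <= 2 * (M r + 1) * 2^-1 ^+ n.
  apply: ler_wpM2r => //; rewrite ler_wpM2l //.
  move: Mt; rewrite ltr_norml; lra.
have := ler_normD (v r - u n r) ((u n r - u n t) + (u n t - v t)).
have := ler_normD (u n r - u n t) (u n t - v t).
rewrite [`|u n t - v t|]distrC.
have -> : v r - u n r + (u n r - u n t + (u n t - v t)) = v r - v t by ring.
lra.
Unshelve. all: by end_near. Qed.

End GeometricLimit.

Section InverseLaplacian.
Context {R : realType}.
Implicit Types (f G H w v : R -> R) (k : nat).

(** The exponential lies above its tangents. *)
Lemma expR_lipschitz (b x y : R) : x <= b -> y <= b ->
  `|expR x - expR y| <= expR b * `|x - y|.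
Proof.
wlog xy : x y / y <= x.
  move=> H xb yb; case: (leP y x) => [|/ltW] xy; first exact: H.
  by rewrite distrC [`|x - y|]distrC; exact: H.
move=> xb yb; rewrite !ger0_norm ?subr_ge0 ?ler_expR //.
apply: (@le_trans _ _ (expR x * (x - y))); last first.
  by rewrite ler_wpM2r ?subr_ge0 // ler_expR.
have := expR_ge1Dx (y - x); rewrite expRD expRN => E.
have x0 := expR_gt0 x.
have : expR x * (1 + (y - x)) <= expR x * (expR y / expR x).
  by rewrite ler_wpM2l // ltW.
rewrite [expR x * (_ / _)]mulrC divfK ?gt_eqF //; lra.
Qed.

Lemma primitiveB G H (r : R) : continuous G -> continuous H ->
  primitive (fun t => G t - H t) r = primitive G r - primitive H r.
Proof.
move=> cG cH; apply/eqP; rewrite -subr_eq0; apply/eqP.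
pose h (t : R) := primitive (fun t => G t - H t) t - (primitive G t - primitive H t).
have dh (t : R) : is_derive t 1 h 0.
  have c : continuous (fun t => G t - H t).
    by move=> x; apply: cvgB; [exact: cG|exact: cH].
  have := is_derive_sub (primitive_deriv t c)
    (is_derive_sub (primitive_deriv t cG) (primitive_deriv t cH)).
  by move/is_derive_eq; apply; rewrite subrr.
by rewrite -/(h r) (is_derive_0_is_cst r 0 dh) /h !primitive0 !subr0.
Qed.

Lemma averageB k G H (r : R) : continuous G -> continuous H ->
  average k (fun t => G t - H t) r = average k G r - average k H r.
Proof.
move=> cG cH; rewrite /average; case: eqP => _; first by rewrite mulrBl.
rewrite -mulrBl -primitiveB; try exact: cont_XM.
by congr (primitive _ _ / _); apply/funext => t; rewrite mulrBr.
Qed.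

(** The bound is inherited because [average_mean] evaluates [G] at a point
    closer to the origin, where the weight is smaller. *)
Lemma average_exp k G (K l r : R) : 0 <= l -> continuous G ->
  (forall t : R, `|G t| <= K * expR (l * t ^+ 2)) ->
  `|average k G r| <= K * expR (l * r ^+ 2) / k.+1%:R.
Proof.
move=> l0 cG HG; have [c cr ->] := average_mean k r cG.
rewrite normrM normfV normr_nat ler_wpM2r ?invr_ge0 //.
apply: (le_trans (HG c)).
have K0 : 0 <= K.
  by have := le_trans (normr_ge0 _) (HG 0); rewrite pmulr_lge0 // expR_gt0.
rewrite ler_wpM2l // ler_expR ler_wpM2l //.
by rewrite -[c ^+ 2]real_normK ?num_real // -[r ^+ 2]real_normK ?num_real //
  lerXn2r ?nnegrE.
Qed.

(** The radial function with Laplacian [G] in dimension [k.+1] and value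
    [c] at the origin. *)
Definition inverse_laplacian k (c : R) G (r : R) : R :=
  c + primitive (fun t : R => t * average k G t) r.

Lemma cont_idM f : continuous f -> continuous (fun t : R => t * f t).
Proof. by move=> cf t; apply: cvgM; [exact: cvg_id|exact: cf]. Qed.

Lemma inverse_laplacian_deriv k c G (r : R) : continuous G ->
  is_derive r 1 (inverse_laplacian k c G) (r * average k G r).
Proof.
move=> cG; rewrite -[X in is_derive _ _ _ X]add0r; apply: is_derive_add.
exact/primitive_deriv/cont_idM/average_cont.
Qed.

Lemma inverse_laplacian_cont k c G : continuous G ->
  continuous (inverse_laplacian k c G).
Proof. by move=> cG; apply: deriv_cont => r; exact: inverse_laplacian_deriv. Qed.

Lemma inverse_laplacian0 k c G : inverse_laplacian k c G 0 = c.
Proof. by rewrite /inverse_laplacian primitive0 addr0. Qed.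

(** A superharmonic radial function is largest at the origin: its derivative
    [r * average k G r] has the sign of [- r]. *)
Lemma inverse_laplacian_le k c G (r : R) : continuous G ->
  (forall t : R, G t <= 0) -> inverse_laplacian k c G r <= c.
Proof.
move=> cG G0.
have av t : average k G t <= 0.
  have [s _ ->] := average_mean k t cG.
  by rewrite mulr_le0_ge0 // invr_ge0.
have cw := @inverse_laplacian_cont k c G cG.
have dw (t : R) := inverse_laplacian_deriv k c t cG.
have cc : continuous (cst c : R -> R) by exact: cst_continuous.
have dc (t : R) : is_derive t 1 (cst c : R -> R) 0 by exact: is_derive_cst.
rewrite -[X in _ <= X](inverse_laplacian0 k c G); have [r0|r0] := leP 0 r.
  have := le_increment r0 (continuous_subspaceT cw) (continuous_subspaceT cc)
     (fun t _ => dw t) (fun t _ => dc t).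
  rewrite /cst subrr subr_le0; apply => t /[!in_itv] /andP[t0 _].
  by rewrite mulr_ge0_le0 // ltW.
have := le_increment (ltW r0) (continuous_subspaceT cc) (continuous_subspaceT cw)
   (fun t _ => dc t) (fun t _ => dw t).
rewrite /cst subrr subr_ge0; apply => t /[!in_itv] /andP[_ t0].
by rewrite mulr_le0 // ltW.
Qed.

Lemma is_derive_gauss (K l : R) (r : R) : is_derive r 1
  (fun t : R => K * expR (l * t ^+ 2)) (r * (2 * l * (K * expR (l * r ^+ 2)))).
Proof.
have d := is_derive_scale K (is_derive_chain
  (g := fun t : R => l * t ^+ 2) (is_derive_expR (l * r ^+ 2))
  (is_derive_scale l (is_derive_X 2 r))).
by apply: is_derive_eq d _; rewrite /= expr1; ring.
Qed.

(** The gain [1 / (2 l k.+1)] comes from integrating [t exp(l t^2)]; taking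
    [l] large makes the inverse Laplacian a contraction in the weighted norm. *)
Lemma inverse_laplacian_exp k c G H (K l r : R) : 0 < l ->
  continuous G -> continuous H ->
  (forall t : R, `|G t - H t| <= K * expR (l * t ^+ 2)) ->
  `|inverse_laplacian k c G r - inverse_laplacian k c H r|
    <= K / (2 * l * k.+1%:R) * expR (l * r ^+ 2).
Proof.
move=> l0 cG cH GH.
have K0 : 0 <= K.
  by have := le_trans (normr_ge0 _) (GH 0); rewrite pmulr_lge0 // expR_gt0.
have k0 : (0 : R) < k.+1%:R by rewrite ltr0n.
pose w t := inverse_laplacian k c G t - inverse_laplacian k c H t.
pose K' := K / (2 * l * k.+1%:R).
pose e (t : R) := K' * expR (l * t ^+ 2).
pose v t := average k (fun t => G t - H t) t.
have cGH : continuous (fun t => G t - H t).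
  by move=> x; apply: cvgB; [exact: cG|exact: cH].
have dw (t : R) : is_derive t 1 w (t * v t).
  have := is_derive_sub (inverse_laplacian_deriv k c t cG)
    (inverse_laplacian_deriv k c t cH).
  by move/is_derive_eq; apply; rewrite /v averageB // mulrBr.
have dNw (t : R) : is_derive t 1 (fun t => - w t) (- (t * v t)) by exact: is_derive_opp.
have de (t : R) : is_derive t 1 e (t * (K * expR (l * t ^+ 2) / k.+1%:R)).
  apply: is_derive_eq (is_derive_gauss _ _ _) _; rewrite /K'; field.
  by rewrite addrC natr1 pnatr_eq0 /= lt0r_neq0.
have bv t : `|v t| <= K * expR (l * t ^+ 2) / k.+1%:R.
  by apply: average_exp => //; exact: ltW.
have w0 : w 0 = 0 by rewrite /w !inverse_laplacian0 subrr.
have e0 t : 0 <= e t.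
  by rewrite /e mulr_ge0 ?expR_ge0 // /K' divr_ge0 // !mulr_ge0 // ltW.
have E0 := e0 0.
have cw := continuous_subspaceT (deriv_cont dw).
have cNw := continuous_subspaceT (deriv_cont dNw).
have ce := continuous_subspaceT (deriv_cont de).
suff : `|w r| <= e r - e 0 by rewrite -/(w r) -/K' -/(e r); lra.
have bb t : - (K * expR (l * t ^+ 2) / k.+1%:R) <= v t <= (K * expR (l * t ^+ 2)
  / k.+1%:R).
  by rewrite -ler_norml.
have [r0|r0] := leP 0 r; rewrite ler_norml lerNl; apply/andP; split.
- have := le_increment r0 (cNw _) (ce _) (fun t _ => dNw t) (fun t _ => de t).
  rewrite w0 oppr0 subr0; apply => t /[!in_itv] /andP[t0 _].
  by rewrite -mulrN (ler_wpM2l (ltW t0)) // lerNl; case/andP: (bb t).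
- have := le_increment r0 (cw _) (ce _) (fun t _ => dw t) (fun t _ => de t).
  rewrite w0 subr0; apply => t /[!in_itv] /andP[t0 _].
  by rewrite (ler_wpM2l (ltW t0)) //; case/andP: (bb t).
- have := le_increment (ltW r0) (ce _) (cNw _) (fun t _ => de t) (fun t _ => dNw t).
  rewrite w0 oppr0 sub0r => H1; suff : e 0 - e r <= - - w r by lra.
  apply: H1 => t /[!in_itv] /andP[_ t0].
  by rewrite -mulrN (ler_wnM2l (ltW t0)) // lerNl; case/andP: (bb t).
- have := le_increment (ltW r0) (ce _) (cw _) (fun t _ => de t) (fun t _ => dw t).
  rewrite w0 sub0r => H1; suff : e 0 - e r <= - w r by lra.
  apply: H1 => t /[!in_itv] /andP[_ t0].
  by rewrite (ler_wnM2l (ltW t0)) //; case/andP: (bb t).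
Qed.

End InverseLaplacian.

(** * The fixed point and its smoothness *)

Section Tower.
Context {R : realType}.
Implicit Types (G H u : R -> R) (k i n : nat) (a : nat -> R).

(** Stage [i] is the [i]-fold inverse Laplacian of [G]; the sequence [a] lists
    the values at the origin from the innermost inverse to the outermost. *)
Fixpoint tower k a G i : R -> R :=
  if i is j.+1 then inverse_laplacian k (a j) (tower k a G j) else G.

Lemma tower_cont k a G i : continuous G -> continuous (tower k a G i).
Proof. by move=> cG; elim: i => //= i; exact: inverse_laplacian_cont. Qed.

Lemma tower_le0 k a G i : continuous G -> (forall r, G r <= 0) ->
  (forall j, (j < i)%N -> a j <= 0) -> forall r, tower k a G i r <= 0.
Proof.
move=> cG G0; elim: i => [|i IH] //= ai r.
apply: le_trans (ai i (ltnSn i)).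
apply: inverse_laplacian_le; first exact: tower_cont.
by apply: IH => j ji; apply: ai; exact: ltnW.
Qed.

Lemma tower_exp k a G H (K l : R) i : 0 < l -> continuous G -> continuous H ->
  (forall t : R, `|G t - H t| <= K * expR (l * t ^+ 2)) ->
  forall r : R, `|tower k a G i r - tower k a H i r| <=
    K / (2 * l * k.+1%:R) ^+ i * expR (l * r ^+ 2).
Proof.
move=> l0 cG cH GH; elim: i => [|i IH] r /=.
  by rewrite expr0 divr1.
rewrite exprSr invfM mulrA.
by apply: inverse_laplacian_exp => //; exact: tower_cont.
Qed.

Lemma le0_geometric (x C : R) : (forall n, x <= C * 2^-1 ^+ n) -> x <= 0.
Proof.
move=> H.
have c : (fun n => C * 2^-1 ^+ n) @ \oo --> (0 : R).
  by apply: cvg_geometric; rewrite ger0_norm ?invr_ge0 // invf_lt1 // ltr1n.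
by apply: (cvgr_to_ge c); apply: nearW.
Qed.

Definition picard_map k a m u := tower k a (fun r => - expR (u r)) m.

Lemma expN_cont u : continuous u -> continuous (fun r => - expR (u r)).
Proof.
move=> cu r; apply: cvgN; apply: continuous_comp; [exact: cu|exact: continuous_expR].
Qed.

(** All iterates stay below [a m], so that the exponential is Lipschitz along
    the iteration with a constant that does not depend on the iterate.  The
    estimate in the norm with weight [exp(- l r^2)] then makes the map a
    contraction on the whole line, and no continuation argument is needed. *)
Lemma picard_fixpoint k a m : (forall i, (i < m)%N -> a i <= 0) ->
  exists u, [/\ continuous u, forall r, u r <= a m & picard_map k a m.+1 u = u].
Proof.
move=> ha; pose P := picard_map k a m.+1.
have Ple u r : continuous u -> P u r <= a m.
  move=> cu; apply: inverse_laplacian_le.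
    by apply: tower_cont; exact: expN_cont.
  by apply: tower_le0 => //; exact: expN_cont.
have Pc u : continuous u -> continuous (P u).
  by move=> cu; apply: tower_cont; exact: expN_cont.
(* [L] is the Lipschitz constant; a gain [1 / q] per inverse Laplacian, with
   [q >= 2 L] and [q >= 1], gives a contraction by [1 / 2]. *)
pose L := expR (a m); pose q := 2 * L + 1.
have L0 : 0 < L by exact: expR_gt0.
pose l := q / (2 * k.+1%:R).
have k0 : (0 : R) < k.+1%:R by rewrite ltr0n.
have q1 : 1 <= q by rewrite /q; lra.
have l0 : 0 < l by rewrite /l divr_gt0 ?mulr_gt0 //; lra.
have lq : 2 * l * k.+1%:R = q.
  by rewrite /l; field; rewrite addrC natr1 pnatr_eq0.
have qm : q <= q ^+ m.+1 by rewrite exprS ler_peMr ?exprn_ege1 //; lra.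
have contr u v C : continuous u -> continuous v ->
    (forall r, u r <= a m) -> (forall r, v r <= a m) -> 0 <= C ->
    (forall r : R, `|u r - v r| <= C * expR (l * r ^+ 2)) ->
    forall r : R, `|P u r - P v r| <= C * 2^-1 * expR (l * r ^+ 2).
  move=> cu cv ua va C0 uv r.
  apply: (@le_trans _ _ (L * C / q ^+ m.+1 * expR (l * r ^+ 2))).
    rewrite -lq; apply: tower_exp => //; [exact: expN_cont|exact: expN_cont|].
    move=> t; rewrite -opprD normrN.
    apply: (le_trans (expR_lipschitz (ua t) (va t))).
    by rewrite -mulrA (ler_wpM2l (ltW L0)) // uv.
  rewrite ler_wpM2r ?expR_ge0 //.
  rewrite ler_pdivrMr; last by apply: lt_le_trans qm; lra.
  rewrite [L * C]mulrC -mulrA ler_wpM2l //; rewrite /q in qm *; lra.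
(* The iteration starts at the image of the constant [a m], so that the first
   increment is also a difference of two values of [P]. *)
have [w [w0 wS]] : exists w : nat -> R -> R, w 0%N = P (cst (a m)) /\
    forall n, w n.+1 = P (w n).
  by exists (fun n => iter n P (P (cst (a m)))).
have cc : continuous (cst (a m) : R -> R) by exact: cst_continuous.
have wc n : continuous (w n).
  by elim: n => [|n IH]; rewrite ?w0 ?wS; exact: Pc.
have wa n r : w n r <= a m.
  by case: n => [|n]; rewrite ?w0 ?wS; apply: Ple => //; exact: wc.
have ww n (r : R) : `|w n.+1 r - w n r| <= L * expR (l * r ^+ 2) * 2^-1 ^+ n.
  rewrite mulrAC; elim: n r => [|n IH] r.
    rewrite expr0 mulr1 wS w0.
    apply: (@le_trans _ _ (L / q ^+ m.+1 * expR (l * r ^+ 2))).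
      rewrite -lq; apply: tower_exp => //; [by apply/expN_cont;
        rewrite -w0|exact: expN_cont|].
      rewrite -w0.
      move=> t; rewrite -opprD normrN /cst -/L.
      have e0 := expR_gt0 (w 0%N t).
      have e1 : expR (w 0%N t) <= L by rewrite ler_expR wa.
      rewrite ler0_norm ?subr_le0 //.
      apply: (@le_trans _ _ L); first lra.
      rewrite ler_peMr ?(ltW L0) // -expR0 ler_expR mulr_ge0 ?(ltW l0) //.
      exact: sqr_ge0.
    rewrite ler_wpM2r ?expR_ge0 // ler_pdivrMr; last by apply: lt_le_trans qm; lra.
    by rewrite ler_peMr ?(ltW L0) //; lra.
  rewrite exprSr [L * (_ * _)]mulrA.
  have C0 : 0 <= L * 2^-1 ^+ n by rewrite mulr_ge0 ?(ltW L0) // exprn_ge0 // invr_ge0.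
  rewrite (wS n.+1) {2}(wS n).
  exact: (contr (w n.+1) (w n) (L * 2^-1 ^+ n) (wc n.+1) (wc n) (wa n.+1) (wa n)
    C0 IH r).
have cM : continuous (fun r : R => L * expR (l * r ^+ 2)).
  exact: deriv_cont (is_derive_gauss L l).
have [v cv Hv] := geometric_limit wc cM ww.
exists v.
have va r : v r <= a m.
  rewrite -subr_le0; apply: (@le0_geometric _ (2 * (L * expR (l * r ^+ 2)))) => n.
  by apply: le_trans (Hv n r); rewrite ler_normr lerB.
split; [exact: cv|exact: va|].
apply/funext => r; apply/eqP; rewrite -subr_eq0 -normr_le0.
apply: (@le0_geometric _ (4 * (L * expR (l * r ^+ 2)))) => n.
have Hv' (t : R) : `|v t - w n t| <= 2 * L * 2^-1 ^+ n * expR (l * t ^+ 2).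
  by apply: (le_trans (Hv n t)); rewrite le_eqVlt; apply/orP; left; apply/eqP; ring.
have h0 : 0 <= (2^-1 : R) ^+ n by rewrite exprn_ge0 // invr_ge0.
have C0 : 0 <= 2 * L * 2^-1 ^+ n by rewrite !mulr_ge0 // ltW.
have b1 := contr v (w n) _ cv (wc n) va (wa n) C0 Hv' r.
have b2 := Hv n.+1 r; rewrite (exprSr 2^-1 n) in b2; rewrite -wS in b1.
apply: (le_trans (ler_distD (w n.+1 r) _ _)).
rewrite [`|w n.+1 r - _|]distrC.
apply: (le_trans (lerD b1 b2)).
set E := expR _ ; set h := _ ^+ n.
rewrite -subr_ge0.
have -> : 4 * (L * E) * h - (2 * L * h / 2 * E + 2 * (L * E) * (h / 2)) = 2 * L
  * h * E by field.
by rewrite mulr_ge0 // expR_ge0.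
Qed.

End Tower.

Section RadialSmooth.
Context {R : realType}.
Implicit Types (f g G : R -> R) (k n : nat).

(** [f] is [n] times differentiable as a function of [r^2]: the relation
    [f' = r g] says that [g / 2] is the derivative of [f] with respect to [r^2].
    This is the regularity of a profile that makes [f(|x|)] of class [C^n] at
    the origin. *)
Fixpoint sq_diff n f : Prop :=
  if n is n'.+1 then exists2 g, sq_diff n' g & forall r : R, is_derive r 1 f (r * g r)
  else continuous f.

Lemma sq_diff_cont n f : sq_diff n f -> continuous f.
Proof. by case: n => //= n [g _ dg]; exact: deriv_cont dg. Qed.

Lemma sq_diffW n f : sq_diff n.+1 f -> sq_diff n f.
Proof.
elim: n f => [|n IH] f; first exact: (@sq_diff_cont 1).
by case=> g dg df; exists g => //; exact: IH.
Qed.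

Lemma sq_diff_cst n (c : R) : sq_diff n (fun=> c).
Proof.
elim: n c => [|n IH] c; first exact: cst_continuous.
by exists (fun=> 0) => // r; rewrite mulr0; exact: (is_derive_cst c r 1).
Qed.

Lemma sq_diff_sqr n : sq_diff n (fun r : R => r ^+ 2).
Proof.
case: n => [|n]; first exact: cont_X.
exists (fun=> 2); first exact: sq_diff_cst.
by move=> r; apply: is_derive_eq (is_derive_X 2 r) _; rewrite /= expr1 mulrC.
Qed.

Lemma sq_diff_add n f g : sq_diff n f -> sq_diff n g -> sq_diff n (fun r => f r + g r).
Proof.
elim: n f g => [|n IH] f g; first by move=> cf cg r; apply: cvgD; [exact: cf|exact: cg].
move=> [f1 nf df] [g1 ng dg]; exists (fun r => f1 r + g1 r); first exact: IH.
by move=> r; rewrite mulrDr; exact: is_derive_add.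
Qed.

Lemma sq_diff_mul n f g : sq_diff n f -> sq_diff n g -> sq_diff n (fun r => f r * g r).
Proof.
elim: n f g => [|n IH] f g; first by move=> cf cg r; apply: cvgM; [exact: cf|exact: cg].
move=> nf ng; have nf' := sq_diffW nf; have ng' := sq_diffW ng.
case: nf ng => [f1 nf df] [g1 ng dg].
exists (fun r => f r * g1 r + g r * f1 r); first by apply: sq_diff_add; exact: IH.
move=> r; apply: is_derive_eq (is_derive_mul (df r) (dg r)) _; ring.
Qed.

Lemma sq_diff_expR n f : sq_diff n f -> sq_diff n (fun r => expR (f r)).
Proof.
elim: n f => [|n IH] f.
  by move=> cf r; apply: continuous_comp; [exact: cf|exact: continuous_expR].
move=> nf; have nf' := sq_diffW nf.
case: nf => [f1 nf df].
exists (fun r => expR (f r) * f1 r); first by apply: sq_diff_mul => //; exact: IH.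
move=> r.
have d := is_derive_chain (f := expR) (g := f) (is_derive_expR (f r)) (df r).
by apply: is_derive_eq d _; rewrite mulrCA.
Qed.

Lemma sq_diff_average n k G : sq_diff n G -> sq_diff n (average k G).
Proof.
elim: n k G => [|n IH] k G; first exact: average_cont.
move=> [H nH dG]; exists (average k.+2 H); first exact: IH.
by move=> r; apply: average_deriv => //; exact: sq_diff_cont nH.
Qed.

Lemma sq_diff_inverse_laplacian n k c G : sq_diff n G -> sq_diff n.+1
  (inverse_laplacian k c G).
Proof.
move=> nG; exists (average k G); first exact: sq_diff_average.
by move=> r; apply: inverse_laplacian_deriv; exact: sq_diff_cont nG.
Qed.

Lemma sq_diff_tower n k a G i : sq_diff n G -> sq_diff n (tower k a G i).
Proof. by move=> nG; elim: i => //= i IH; exact/sq_diffW/sq_diff_inverse_laplacian. Qed.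

(** Bootstrap: the fixed point gains one derivative over [exp u] each time
    it is rewritten as an inverse Laplacian. *)
Lemma sq_diff_picard k a m u : continuous u -> picard_map k a m.+1 u = u ->
  forall n, sq_diff n u.
Proof.
move=> cu Pu; elim=> [//|n IH]; rewrite -Pu.
apply: sq_diff_inverse_laplacian; apply: sq_diff_tower.
rewrite (_ : (fun r => _) = fun r => (-1) * expR (u r)).
  by apply: sq_diff_mul; [exact: sq_diff_cst|exact: sq_diff_expR].
by apply/funext => r; rewrite mulN1r.
Qed.

End RadialSmooth.

(** * Radial functions of several variables *)

(** A function with increments [o(|y - x|)] is differentiable at [x] with
    zero differential; used at the origin, where the Euclidean norm is not
    differentiable. *)
Lemma is_derive_flat {R : realFieldType} {V W : normedModType R} (x : V) (h : V -> W) :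
  (forall e : R, 0 < e -> \forall y \near x, `|h y - h x| <= e * `|y - x|) ->
  differentiable h x /\ forall v, is_derive x v h 0.
Proof.
move=> H.
have E : h \o shift x = cst (h x) + (\0 : {linear V -> W}) +o_ 0 id.
  apply/eqaddoP => e e0.
  have := H e e0; rewrite (near_shift 0) subr0.
  apply: filterS => y /=.
  by rewrite /cst /= addrK !fctE /= addr0.
have c0 : continuous (\0 : {linear V -> W}) by exact: cst_continuous.
have D := diff_unique c0 E.
have df : differentiable h x.
  by apply/diff_locallyP; rewrite D; split.
split=> // v; apply: DeriveDef; first exact: diff_derivable.
by rewrite deriveE // D.
Qed.

Section Enorm.
Context {R : realType} {N : nat}.
Implicit Types (x y : 'rV[R]_N) (f g : R -> R) (h : 'rV[R]_N -> R).

Definition sqn x : R := \sum_i x ord0 i ^+ 2.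

Lemma sqn_ge0 x : 0 <= sqn x.
Proof. by apply: sumr_ge0 => i _; exact: sqr_ge0. Qed.

Lemma enorm_ge0 x : 0 <= enorm x.
Proof. exact: sqrtr_ge0. Qed.

Lemma enorm_sq x : enorm x ^+ 2 = sqn x.
Proof. by rewrite sqr_sqrtr // sqn_ge0. Qed.

Lemma enorm0 : enorm (0 : 'rV[R]_N) = 0.
Proof.
rewrite /enorm big1 ?sqrtr0 // => i _; by rewrite mxE expr0n.
Qed.

Lemma enorm_gt0 x : x != 0 -> 0 < enorm x.
Proof.
move=> x0; rewrite sqrtr_gt0 lt_neqAle sqn_ge0 andbT eq_sym.
apply: contra_neq x0 => /eqP; rewrite psumr_eq0; last by move=> i _; exact: sqr_ge0.
move=> /allP H; apply/rowP => i; rewrite mxE; apply/eqP; rewrite -sqrf_eq0.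
by have := H i; rewrite mem_index_enum; apply.
Qed.

Lemma coord_le_norm x i : `|x ord0 i| <= `|x|.
Proof.
rewrite [leRHS]/Num.Def.normr /= mx_normrE.
by apply: (@le_trans _ _ (\big[Order.max/0]_(k : 'I_1 * 'I_N) `|x k.1 k.2|)) => //;
  exact: (le_bigmax _ (fun k : 'I_1 * 'I_N => `|x k.1 k.2|) (ord0, i)).
Qed.

(** Comparison with the max norm, which defines the topology. *)
Lemma enorm_le x : enorm x <= N%:R * `|x|.
Proof.
rewrite -(@ler_pXn2r _ 2) ?nnegrE ?enorm_ge0 ?mulr_ge0 // enorm_sq.
apply: (@le_trans _ _ (\sum_(i < N) `|x| ^+ 2)).
  apply: ler_sum => i _; rewrite -[x ord0 i ^+ 2]real_normK ?num_real //.
  by rewrite lerXn2r ?nnegrE // coord_le_norm.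
rewrite sumr_const card_ord exprMn -[_ *+ N]mulr_natl ler_wpM2r ?sqr_ge0 //.
by rewrite -natrX ler_nat; case: (N) => // n; rewrite expnS leq_pmulr // expn1.
Qed.

Lemma coord_deriv x (i j : 'I_N) :
  is_derive x (delta_mx ord0 i) (fun y : 'rV[R]_N => y ord0 j) (i == j)%:R.
Proof.
have d : derivable (fun y : 'rV[R]_N => y) x (delta_mx ord0 i) by exact: derivable_id.
have /derivable_mxP d' := d.
apply: DeriveDef; first exact: d'.
have := derive_mx d; rewrite (derive_id x) => /matrixP/(_ ord0 j).
by rewrite !mxE /= eq_sym => ->.
Qed.

Lemma coord_diff x (j : 'I_N) : differentiable (fun y : 'rV[R]_N => y ord0 j) x.
Proof. exact: differentiable_coord. Qed.

Lemma sqn_diff x : differentiable sqn x.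
Proof.
have -> : sqn = \sum_(i < N) (fun y => y ord0 i * y ord0 i).
  by apply/funext => y; rewrite fct_sumE; apply: eq_bigr => i _; rewrite expr2.
by apply: differentiable_sum => i; apply: differentiableM; exact: coord_diff.
Qed.

Lemma sqn_deriv x i : is_derive x (delta_mx ord0 i) sqn (2 * x ord0 i).
Proof.
have -> : sqn = \sum_(j < N) (fun y => y ord0 j ^+ 2).
  by apply/funext => y; rewrite fct_sumE.
have -> : 2 * x ord0 i = \sum_(j < N) (2 * x ord0 j * (i == j)%:R).
  rewrite (bigD1 i) //= eqxx mulr1 big1 ?addr0 // => j ji.
  by rewrite eq_sym (negPf ji) mulr0.
apply: is_derive_sum => j.
by have := is_derive_pow 2 (coord_deriv x i j); rewrite /= expr1.
Qed.

Lemma enorm_diff x : x != 0 -> differentiable (@enorm R N) x.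
Proof.
move=> x0; have := enorm_gt0 x0; rewrite sqrtr_gt0 => s0.
apply: (@differentiable_comp _ _ _ _ sqn Num.sqrt); first exact: sqn_diff.
by apply/derivable1_diffP; have [] := is_derive1_sqrt s0.
Qed.

Lemma enorm_deriv x i : x != 0 ->
  is_derive x (delta_mx ord0 i) (@enorm R N) (x ord0 i / enorm x).
Proof.
move=> x0; have := enorm_gt0 x0; rewrite sqrtr_gt0 => s0.
have := is_derive_comp (is_derive1_sqrt s0) (sqn_diff x) (sqn_deriv x i).
move=> d; apply: is_derive_eq d _; rewrite -/(enorm x).
by field; rewrite gt_eqF // sqrtr_gt0.
Qed.

Lemma radial_diff_neq0 f x (d : R) : x != 0 -> is_derive (enorm x) 1 f d ->
  differentiable (radial f : 'rV[R]_N -> R) x.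
Proof.
move=> x0 [/derivable1_diffP df _].
by apply: differentiable_comp => //; exact: enorm_diff.
Qed.

Lemma radial_deriv_neq0 f x (d : R) i : x != 0 ->
  is_derive (enorm x) 1 f (enorm x * d) ->
  is_derive x (delta_mx ord0 i) (radial f) (x ord0 i * d).
Proof.
move=> x0 df.
have h := is_derive_comp df (enorm_diff x0) (enorm_deriv i x0).
apply: is_derive_eq h _; have := enorm_gt0 x0 => s0.
by field; rewrite gt_eqF.
Qed.

(** At the origin a profile with [f'(0) = 0] satisfies
    [f(|x|) - f(0) = o(|x|)]. *)
Lemma radial_flat f : is_derive (0 : R) 1 f 0 ->
  differentiable (radial f) (0 : 'rV[R]_N) /\
  forall v, is_derive (0 : 'rV[R]_N) v (radial f) 0.
Proof.
move=> df; apply: is_derive_flat => e e0.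
have /is_derive1_caratheodory [q [Hq cq q0]] := df.
pose e' := e / N.+1%:R.
have e'0 : 0 < e' by rewrite divr_gt0.
have : \forall r \near (0 : R), `|q r| < e'.
  have /cvgrPdist_lt/(_ _ e'0) := cq; rewrite q0.
  by apply: filterS => r; rewrite sub0r normrN.
move=> [d /= d0 Hd].
have d'0 : 0 < d / N.+1%:R by rewrite divr_gt0.
have : \forall y \near (0 : 'rV[R]_N), ball 0 (d / N.+1%:R) y by exact: nbhsx_ballx.
apply: filterS => y.
rewrite -ball_normE /ball_ /= sub0r normrN => yd.
have ey : enorm y <= N.+1%:R * `|y|.
  by apply: (le_trans (enorm_le y)); rewrite ler_wpM2r // ler_nat.
rewrite subr0 /radial enorm0 Hq subr0 normrM.
have q1 : `|q (enorm y)| < e'.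
  apply: Hd; rewrite /= sub0r normrN ger0_norm ?enorm_ge0 //.
  apply: (le_lt_trans ey); move: yd; rewrite ltr_pdivlMr //; lra.
rewrite (ger0_norm (enorm_ge0 _)).
apply: (@le_trans _ _ (e' * (N.+1%:R * `|y|))).
  by apply: ler_pM => //; rewrite ?enorm_ge0 // ltW.
by rewrite mulrA /e' divfK // pnatr_eq0.
Qed.

Lemma radial_diff f g : (forall r : R, is_derive r 1 f (r * g r)) ->
  forall x, differentiable (radial f) x.
Proof.
move=> df x; have [->|x0] := eqVneq x 0; last exact: radial_diff_neq0 x0 (df _).
by have := df 0; rewrite mul0r => /radial_flat[].
Qed.

Lemma radial_deriv f g : (forall r : R, is_derive r 1 f (r * g r)) ->
  forall x i, is_derive x (delta_mx ord0 i) (radial f) (x ord0 i * radial g x).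
Proof.
move=> df x i; have [->|x0] := eqVneq x 0; last exact: radial_deriv_neq0 x0 (df _).
by rewrite mxE mul0r; have := df 0; rewrite mul0r => /radial_flat[_]; apply.
Qed.

Lemma is_derive_partial i h x (d : R) :
  is_derive x (delta_mx ord0 i) h d -> partial i h x = d.
Proof. by move=> H; rewrite /partial derive_val. Qed.

End Enorm.

Section Smooth.
Context {R : realType} {N : nat}.
Implicit Types (x y : 'rV[R]_N) (f g : R -> R) (h : 'rV[R]_N -> R).

(** A class of functions closed under partial derivatives, at the cost of one
    order, since the derivative of [f(|x|)] along the [i]-th axis is
    [x_i g(|x|)] when [f' = r g]. *)
Inductive poly_radial n : ('rV[R]_N -> R) -> Prop :=
| poly_radial_cst c : poly_radial n (fun=> c)
| poly_radial_coord i : poly_radial n (fun x => x ord0 i)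
| poly_radial_radial f : sq_diff n f -> poly_radial n (radial f)
| poly_radial_add h1 h2 : poly_radial n h1 -> poly_radial n h2 ->
    poly_radial n (fun x => h1 x + h2 x)
| poly_radial_mul h1 h2 : poly_radial n h1 -> poly_radial n h2 ->
    poly_radial n (fun x => h1 x * h2 x).

Lemma poly_radialW n h : poly_radial n.+1 h -> poly_radial n h.
Proof.
elim=> [c|i|f /sq_diffW|h1 h2 _ H1 _ H2|h1 h2 _ H1 _ H2].
- exact: poly_radial_cst.
- exact: poly_radial_coord.
- exact: poly_radial_radial.
- exact: poly_radial_add.
- exact: poly_radial_mul.
Qed.

Lemma poly_radial_diff n h x : poly_radial n.+1 h -> differentiable h x.
Proof.
elim=> [c|i|f [g _ df]|h1 h2 _ H1 _ H2|h1 h2 _ H1 _ H2].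
- exact: differentiable_cst.
- exact: coord_diff.
- exact: radial_diff df x.
- exact: differentiableD.
- exact: differentiableM.
Qed.

Lemma poly_radial_partial n h i : poly_radial n.+1 h -> poly_radial n (partial i h).
Proof.
have dd (h' : 'rV[R]_N -> R) x : poly_radial n.+1 h' ->
    is_derive x (delta_mx ord0 i) h' (partial i h' x).
  by move=> ph; apply/derivableP/diff_derivable/(poly_radial_diff x ph).
elim=> [c|j|f [g ng df]|h1 h2 P1 H1 P2 H2|h1 h2 P1 H1 P2 H2].
- rewrite (_ : partial i _ = fun=> 0); first exact: poly_radial_cst.
  by apply/funext => x; apply: is_derive_partial; exact: is_derive_cst.
- rewrite (_ : partial i _ = fun=> (i == j)%:R); first exact: poly_radial_cst.
  by apply/funext => x; apply: is_derive_partial; exact: coord_deriv.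
- rewrite (_ : partial i _ = fun x => x ord0 i * radial g x).
    by apply: poly_radial_mul; [exact: poly_radial_coord|exact: poly_radial_radial].
  by apply/funext => x; apply: is_derive_partial; exact: radial_deriv.
- rewrite (_ : partial i _ = fun x => partial i h1 x + partial i h2 x).
    exact: poly_radial_add.
  by apply/funext => x; apply: is_derive_partial; apply: is_derive_add; exact: dd.
- rewrite (_ : partial i _ = fun x => h1 x * partial i h2 x + h2 x * partial i h1 x).
    by apply: poly_radial_add; apply: poly_radial_mul => //; exact: poly_radialW.
  by apply/funext => x; apply: is_derive_partial; apply: is_derive_mul; exact: dd.
Qed.

Lemma poly_radial_smooth h : (forall n, poly_radial n h) ->
  forall A, smooth_on A h.
Proof.
move=> ph A s x _.
have : forall n, poly_radial n (foldr partial h s).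
  by elim: s => //= i s IH n; exact: poly_radial_partial.
by move=> /(_ 1%N); exact: poly_radial_diff.
Qed.

Lemma radial_smooth f : (forall n, sq_diff n f) -> forall A, smooth_on A (radial
  f : 'rV[R]_N -> R).
Proof.
by move=> nf; apply: poly_radial_smooth => n; exact: poly_radial_radial.
Qed.

(** Pointwise version away from the origin, where [f] and [g] need not
    extend smoothly to [r = 0]. *)
Lemma laplacian_radial_at f g q x : x != 0 ->
  (\forall y \near x, is_derive (enorm y) 1 f (enorm y * g (enorm y))) ->
  is_derive (enorm x) 1 g (enorm x * q) ->
  laplacian (radial f : 'rV[R]_N -> R) x = N%:R * g (enorm x) + enorm x ^+ 2 * q.
Proof.
move=> x0 nf dg; rewrite /laplacian enorm_sq /sqn.
have nx0 : \forall y \near x, y != 0.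
  have x1 : 0 < `|x| by rewrite normr_gt0.
  apply: filterS (nbhsx_ballx x _ x1) => y.
  by rewrite -ball_normE /ball_ /=; apply: contraTneq => ->; rewrite subr0 ltxx.
have E i : partial i (partial i (radial f)) x = g (enorm x) + x ord0 i ^+ 2 * q.
  apply: is_derive_partial.
  apply: (@near_eq_is_derive _ _ _ (fun y : 'rV[R]_N => y ord0 i * radial g y)).
    near=> y; apply/esym/is_derive_partial/radial_deriv_neq0; first by near: y.
    by near: y.
  apply: is_derive_eq.
    by apply: is_derive_mul; [exact: coord_deriv|exact: radial_deriv_neq0 x0 dg].
  by rewrite /= eqxx mulr1 /radial expr2; ring.
rewrite (eq_bigr _ (fun i _ => E i)) big_split /= sumr_const card_ord mulr_natl.
by rewrite mulr_suml.
Unshelve. all: by end_near. Qed.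

Lemma laplacian_radial f g q : (forall r : R, is_derive r 1 f (r * g r)) ->
  (forall r : R, is_derive r 1 g (r * q r)) ->
  laplacian (radial f : 'rV[R]_N -> R) = radial (fun r => N%:R * g r + r ^+ 2 * q r).
Proof.
move=> df dg; apply/funext => x; rewrite /laplacian {2}/radial enorm_sq /sqn.
have E i : partial i (partial i (radial f)) x = g (enorm x) + x ord0 i ^+ 2 * q
  (enorm x).
  rewrite (_ : partial i (radial f) = fun y : 'rV[R]_N => y ord0 i * radial g y).
    apply: is_derive_partial; apply: is_derive_eq.
      by apply: is_derive_mul; [exact: coord_deriv|exact: radial_deriv dg x i].
    by rewrite /= eqxx mulr1 /radial expr2; ring.
  by apply/funext => y; apply: is_derive_partial; exact: radial_deriv.
rewrite (eq_bigr _ (fun i _ => E i)) big_split /= sumr_const card_ord mulr_natl.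
by rewrite mulr_suml.
Qed.

(** With [v = average k G] the Laplacian is [N v + r v'], which equals [G]
    by [average_ibp]. *)
Lemma laplacian_inverse k c G : N = k.+1 -> sq_diff 1 G ->
  laplacian (radial (inverse_laplacian k c G) : 'rV[R]_N -> R) = radial G.
Proof.
move=> Nk [H cH dG]; have cG := deriv_cont dG.
have L := @laplacian_radial (inverse_laplacian k c G) (average k G) (average k.+2 H)
  (fun r => inverse_laplacian_deriv k c r cG) (fun r => average_deriv k r cH dG).
rewrite L; apply/funext => x; rewrite /radial (average_ibp k _ cH dG).
move: (enorm x) => r; rewrite Nk.
by field; rewrite addrC natr1 pnatr_eq0.
Qed.

Lemma iter_laplacian_tower k a G m j : N = k.+1 -> sq_diff 1 G -> (j <= m)%N ->
  iter j laplacian (radial (tower k a G m) : 'rV[R]_N -> R) =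
  radial (tower k a G (m - j)).
Proof.
move=> Nk nG; elim: j => [|j IH] jm; first by rewrite subn0.
rewrite iterS IH ?(ltnW jm) // -(subnSK jm) /=.
by apply: laplacian_inverse => //; exact: sq_diff_tower.
Qed.

End Smooth.

Section OddDerivatives.
Context {R : realType}.
Implicit Types (f g : R -> R).

(** Two derivatives of a function of [r^2] give a function of [r^2] again:
    [(r g)' = g + r^2 g_1] when [g' = r g_1]. *)
Lemma derive1n_even_odd n f : sq_diff n f ->
  (forall k, (2 * k <= n)%N -> sq_diff (n - 2 * k) (derive1n (2 * k) f)).
Proof.
move=> nf; elim=> [|k IH] kn; first by rewrite muln0 subn0 derive1n0.
have := IH (ltac:(lia)); have -> : (n - 2 * k = (n - 2 * k.+1).+2)%N by lia.
set p := (n - _)%N; have -> : (2 * k.+1 = (2 * k).+2)%N by lia.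
set F := derive1n _ _ => -[g ng dF].
rewrite !derive1nS -/F.
have -> : derive1 F = fun r => r * g r.
  by apply/funext => r; rewrite derive1E derive_val.
have ng' := sq_diffW ng.
have -> : derive1 (fun r => r * g r) = fun r => g r + r ^+ 2 * (sval (cid2 ng)) r.
  apply/funext => r; rewrite derive1E; case: cid2 => q nq dq /=.
  have d := is_derive_mul (is_derive_id1 r) (dq r).
  by rewrite derive_val mulr1 addrC; congr (_ + _); ring.
case: cid2 => q nq dq /=.
by apply: sq_diff_add => //; apply: sq_diff_mul => //; exact: sq_diff_sqr.
Qed.

(** An odd derivative is [r] times a continuous function. *)
Lemma derive1n_odd0 f k : (forall n, sq_diff n f) ->
  derive1n (2 * k).+1 f r @[r --> 0^'+] --> (0 : R).
Proof.
move=> nf; have := @derive1n_even_odd (2 * k).+1 f (nf _) k (leqnSn _).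
rewrite subSn // subnn => -[g cg dF].
rewrite derive1nS (_ : derive1 _ = fun r => r * g r); last first.
  by apply/funext => r; rewrite derive1E derive_val.
apply: cvg_at_right_filter.
have c : (fun r : R => r * g r) @ (0 : R) --> 0 * g 0.
  by apply: cvgM; [exact: cvg_id|exact: cg].
by rewrite mul0r in c.
Qed.

End OddDerivatives.

(** * Comparison and growth *)

Section Comparison.
Context {R : realType}.
Implicit Types (f g G w v u : R -> R) (k : nat).

Lemma within_cont (f : R -> R) (a b : R) :
  (forall x, a <= x <= b -> {for x, continuous f}) -> {within `[a, b], continuous f}.
Proof.
by move=> H; apply: continuous_in_subspaceT => x /[!inE] /= /[!in_itv] /=; exact: H.
Qed.

(** Weighted estimate for solutions of the flux equations known only on a
    bounded interval and away from the origin.  The flux [r^(k+1) v] is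
    compared with that of a multiple of [exp(l r^2)], whose Laplacian exceeds
    [exp(l r^2)] times the same multiple of [2 l k.+1]. *)
Lemma flux_exp_bound k (b : R) w v G (K l : R) : 0 < l -> 0 <= K ->
  {within `[0, b], continuous w} ->
  {within `[0, b], continuous (fun r => r ^+ k.+1 * v r)} ->
  (forall r : R, 0 < r < b -> is_derive r 1 w (r * v r)) ->
  (forall r : R, 0 < r < b ->
     is_derive r 1 (fun r => r ^+ k.+1 * v r) (r ^+ k * G r)) ->
  (forall r : R, 0 < r < b -> `|G r| <= K * expR (l * r ^+ 2)) ->
  forall r : R, 0 <= r <= b ->
    `|w r - w 0| <= K / (2 * l * k.+1%:R) * expR (l * r ^+ 2).
Proof.
move=> l0 K0 cw cz dw dz HG.
have k0 : (0 : R) < k.+1%:R by rewrite ltr0n.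
pose e (r : R) := K * expR (l * r ^+ 2).
have e0 r : 0 <= e r by rewrite mulr_ge0 // expR_ge0.
have de r := is_derive_gauss K l r.
pose z (r : R) := r ^+ k.+1 * v r.
(* The flux of [E] below; its derivative is at least [r^k e r]. *)
pose Z (r : R) := k.+1%:R^-1 * (r ^+ k.+1 * e r).
have dZ (r : R) : is_derive r 1 Z (r ^+ k * e r + k.+1%:R^-1 * (2 * l * r ^+
  k.+2 * e r)).
  apply: is_derive_eq (is_derive_scale _ (is_derive_mul (is_derive_X k.+1 r) (de r))) _.
  rewrite /= -/(e r) !exprS; field; by rewrite addrC natr1 pnatr_eq0.
have Z0 : Z 0 = 0 by rewrite /Z expr0n /= mul0r mulr0.
have z0 : z 0 = 0 by rewrite /z expr0n /= mul0r.
have HZ r : 0 < r -> r ^+ k * e r <= r ^+ k * e r + k.+1%:R^-1 * (2 * l * r ^+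
  k.+2 * e r).
  move=> r0; rewrite lerDl; apply: mulr_ge0; first by rewrite invr_ge0 ltW.
  apply: mulr_ge0 => //; apply: mulr_ge0; first by apply: mulr_ge0 => //; exact: ltW.
  exact/exprn_ge0/ltW.
have bv r : 0 < r < b -> `|v r| <= e r / k.+1%:R.
  move=> /andP[r0 rb].
  have sub : `[0, r] `<=` `[0, b].
    by apply: subset_itvl; rewrite bnd_simp ltW.
  have cz' : {within `[0, r], continuous z} by exact: continuous_subspaceW cz.
  have cZ : {within `[0, r], continuous Z} by exact/continuous_subspaceT/deriv_cont.
  have cnz : {within `[0, r], continuous (fun t => - z t)}.
    by move=> t; apply: cvgN; exact: cz'.
  have Hin (t : R) : t \in `]0, r[%R -> 0 < t < b.
    by rewrite in_itv /= => /andP[-> tr]; exact: lt_trans tr rb.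
  have gb (t : R) : t \in `]0, r[%R -> `|t ^+ k * G t| <=
      t ^+ k * e t + k.+1%:R^-1 * (2 * l * t ^+ k.+2 * e t).
    move=> tr; have tb := Hin _ tr; have /andP[t0 _] := tb.
    apply: le_trans (HZ t t0); rewrite normrM ger0_norm ?exprn_ge0 ?(ltW t0) //.
    by rewrite ler_wpM2l ?exprn_ge0 ?(ltW t0) // HG.
  have H1 : z r - z 0 <= Z r - Z 0.
    apply: (le_increment (ltW r0) cz' cZ (fun t tr =>
      dz t (Hin t tr)) (fun t _ => dZ t)) => t tr.
    by apply: le_trans (gb t tr); exact: ler_norm.
  have H2 : - z r - - z 0 <= Z r - Z 0.
    apply: (le_increment (ltW r0) cnz cZ (fun t tr =>
      is_derive_opp (dz t (Hin t tr))) (fun t _ => dZ t)) => t tr.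
    by apply: le_trans (gb t tr); rewrite -normrN; exact: ler_norm.
  rewrite z0 Z0 in H1 H2.
  have rk : 0 < r ^+ k.+1 by rewrite exprn_gt0.
  rewrite -(ler_pM2l rk).
  have -> : r ^+ k.+1 * (e r / k.+1%:R) = Z r by rewrite /Z; ring.
  rewrite -[r ^+ k.+1 in leLHS]gtr0_norm // -normrM -/(z r) ler_norml; lra.
pose E (r : R) := K / (2 * l * k.+1%:R) * expR (l * r ^+ 2).
have dE (r : R) : is_derive r 1 E (r * (e r / k.+1%:R)).
  apply: is_derive_eq (is_derive_gauss _ _ _) _; rewrite /e; field.
  by rewrite addrC natr1 pnatr_eq0 /= lt0r_neq0.
have E0 : 0 <= E 0.
  by rewrite /E mulr_ge0 ?expR_ge0 // divr_ge0 // !mulr_ge0 // ltW.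
move=> r /andP[r0 rb]; rewrite -/(E r).
have sub : `[0, r] `<=` `[0, b] by apply: subset_itvl; rewrite bnd_simp.
have cw' : {within `[0, r], continuous w} by exact: continuous_subspaceW cw.
have cE : {within `[0, r], continuous E} by exact/continuous_subspaceT/deriv_cont.
have cnw : {within `[0, r], continuous (fun t => - w t)}.
  by move=> t; apply: cvgN; exact: cw'.
have Hin (t : R) : t \in `]0, r[%R -> 0 < t < b.
  by rewrite in_itv /= => /andP[-> tr]; exact: lt_le_trans tr rb.
have H1 : w r - w 0 <= E r - E 0.
  apply: (le_increment r0 cw' cE (fun t tr => dw t (Hin t tr)) (fun t _ =>
    dE t)) => t tr.
  have tb := Hin _ tr; have /andP[t0 _] := tb.
  by rewrite (ler_wpM2l (ltW t0)) //; apply: le_trans (bv t tb); exact: ler_norm.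
have H2 : - w r - - w 0 <= E r - E 0.
  apply: (le_increment r0 cnw cE (fun t tr => is_derive_opp (dw t (Hin t tr)))
    (fun t _ => dE t)) => t tr.
  have tb := Hin _ tr; have /andP[t0 _] := tb.
  rewrite -mulrN (ler_wpM2l (ltW t0)) //; apply: le_trans (bv t tb).
  by rewrite -normrN; exact: ler_norm.
rewrite ler_norml; lra.
Qed.

(** The average of [t^p] with weight [t^k] is [s^p / (k + 1 + p)]. *)
Lemma average_le_pow k G (C b : R) p : continuous G ->
  (forall t : R, 0 <= t <= b -> G t <= - (C * t ^+ p)) ->
  forall s : R, 0 < s <= b -> average k G s <= - (C / (k.+1 + p)%:R * s ^+ p).
Proof.
move=> cG HG s /andP[s0 sb].
have D0 : (0 : R) < (k.+1 + p)%:R by rewrite ltr0n.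
pose Z (r : R) := - (C / (k.+1 + p)%:R) * r ^+ (k.+1 + p).
have dZ (r : R) : is_derive r 1 Z (r ^+ k * - (C * r ^+ p)).
  apply: is_derive_eq (is_derive_scale _ (is_derive_X (k.+1 + p) r)) _.
  rewrite addSn /= exprD -addSn; set D := _%:R in D0 *.
  by field; rewrite gt_eqF.
have dA r := average_pow_deriv k r cG.
have := le_increment (ltW s0) (continuous_subspaceT (deriv_cont dA))
  (continuous_subspaceT (deriv_cont dZ)) (fun t _ => dA t) (fun t _ => dZ t).
rewrite /Z !expr0n /= !(mul0r, mulr0, subr0) => H.
have sk : 0 < s ^+ k.+1 by rewrite exprn_gt0.
rewrite -(ler_pM2l sk); apply: le_trans (H _) _.
  move=> t /[!in_itv] /= /andP[t0 ts].
  rewrite ler_wpM2l ?exprn_ge0 ?(ltW t0) // HG // (ltW t0) /=.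
  exact: le_trans (ltW ts) sb.
rewrite exprD; lra.
Qed.

Lemma inverse_laplacian_le_pow k (c : R) G (C b : R) p : continuous G -> c <= 0 ->
  (forall t : R, 0 <= t <= b -> G t <= - (C * t ^+ p)) ->
  forall s : R, 0 <= s <= b ->
    inverse_laplacian k c G s <= - (C / (k.+1 + p)%:R / p.+2%:R * s ^+ p.+2).
Proof.
move=> cG c0 HG s /andP[s0 sb].
pose D := C / (k.+1 + p)%:R.
pose Z (r : R) := - (D / p.+2%:R) * r ^+ p.+2.
have p0 : (0 : R) < p.+2%:R by rewrite ltr0n.
have dZ (r : R) : is_derive r 1 Z (r * - (D * r ^+ p)).
  apply: is_derive_eq (is_derive_scale _ (is_derive_X p.+2 r)) _.
  rewrite /= exprS; set q := _%:R in p0 *.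
  by field; rewrite gt_eqF.
have dw r := inverse_laplacian_deriv k c r cG.
have := le_increment s0 (continuous_subspaceT (deriv_cont dw))
  (continuous_subspaceT (deriv_cont dZ)) (fun t _ => dw t) (fun t _ => dZ t).
rewrite inverse_laplacian0 /Z expr0n /= mulr0 subr0 -/D => H.
suff : inverse_laplacian k c G s - c <= - (D / p.+2%:R) * s ^+ p.+2 by (rewrite
  mulNr => H1; apply: (le_trans _ H1); rewrite lerDl oppr_ge0).
apply: H => t /[!in_itv] /= /andP[t0 ts].
rewrite (ler_wpM2l (ltW t0)) //; apply: average_le_pow HG _ _ => //.
by rewrite t0 /=; exact: le_trans (ltW ts) sb.
Qed.

(** On [[0, r]] the source [- e^u] is at most [- e^(u(r))], because [u] is
    nonincreasing.  Raising this bound through the [m] lower stages of the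
    cascade gives [u'(r) <= - C e^(u(r)) r^(2m+1)], a differential inequality
    for [e^(-u)] whose integral is independent of the initial value. *)
Lemma picard_growth k (a : nat -> R) m u : (forall i, (i < m)%N -> a i <= 0) ->
  continuous u -> picard_map k a m.+1 u = u ->
  let Q := (2 * m.+1 * (k.+1 + 2 * m.+1))%:R : R in
  forall r : R, 0 <= r ->
    expR (- a m) + r ^+ (2 * m.+1) / Q ^+ m.+1 <= expR (- u r).
Proof.
move=> a0 cu Pu Q.
have Q0 : 0 < Q by rewrite ltr0n; lia.
pose G r := - expR (u r).
have cG : continuous G by exact: expN_cont.
have du (r : R) : is_derive r 1 u (r * average k (tower k a G m) r).
  by rewrite -{1}Pu; apply: inverse_laplacian_deriv; exact: tower_cont.
have u0 : u 0 = a m by rewrite -Pu /picard_map /= inverse_laplacian0.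
have cl i := @tower_cont R k a G i cG.
have ln r : tower k a G m r <= 0.
  by apply: tower_le0 => // t; rewrite oppr_le0 expR_ge0.
(* [u] is nonincreasing on the half-line, as its Laplacian is nonpositive. *)
have udec (s r : R) : 0 <= s -> s <= r -> u r <= u s.
  move=> s0 sr; rewrite -subr_le0.
  have cc : continuous (cst 0 : R -> R) by exact: cst_continuous.
  have := le_increment sr (continuous_subspaceT cu) (continuous_subspaceT cc)
     (fun t _ => du t) (fun t _ => is_derive_cst 0 t 1).
  rewrite subrr; apply => t /[!in_itv] /= /andP[st _].
  have [c _ ->] := average_mean k t (cl m).
  by rewrite mulr_ge0_le0 ?(le_trans s0 (ltW st)) // mulr_le0_ge0 // invr_ge0.
have lev (r : R) i : (i <= m)%N -> 0 <= r -> forall s : R, 0 <= s <= r ->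
    tower k a G i s <= - (expR (u r) / Q ^+ i * s ^+ (2 * i)).
  move=> + r0; elim: i => [_ s /andP[s0 sr]|i IH im s sr].
    by rewrite muln0 !expr0 divr1 mulr1 lerN2 ler_expR udec.
  have /andP[s0 _] := sr.
  have := inverse_laplacian_le_pow k (cl i) (a0 i im) (IH (ltnW im)) sr.
  move/le_trans; apply; rewrite mulnS add2n lerN2.
  rewrite ler_wpM2r ?exprn_ge0 // exprS -!mulrA ler_wpM2l ?expR_ge0 //.
  rewrite invfM mulrC ler_wpM2l ?invr_ge0 ?exprn_ge0 ?(ltW Q0) //.
  have hQ : (k.+1 + 2 * i)%:R * (2 * i).+2%:R <= Q.
    by rewrite /Q -natrM ler_nat mulnC; apply: leq_mul; lia.
  by rewrite -invfM lef_pV2 ?posrE ?mulr_gt0 ?ltr0n.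
move=> r r0.
pose p := (2 * m)%N.
pose Z (t : R) := (Q ^+ m.+1)^-1 * t ^+ p.+2.
have dZ (t : R) : is_derive t 1 Z ((Q ^+ m.+1)^-1 * (p.+2%:R * t ^+ p.+1)).
  exact: is_derive_scale (is_derive_X p.+2 t).
pose h (t : R) := expR (- u t).
have dh (t : R) : is_derive t 1 h (expR (- u t) * - (t * average k (tower k a G m) t)).
  exact: (is_derive_chain (f := expR) (g := fun t =>
    - u t) (is_derive_expR _) (is_derive_opp (du t))).
have := le_increment r0 (continuous_subspaceT (deriv_cont dZ))
  (continuous_subspaceT (deriv_cont dh)) (fun t _ => dZ t) (fun t _ => dh t).
rewrite /Z /h expr0n /= mulr0 subr0 u0 => H.
have -> : (2 * m.+1 = p.+2)%N by rewrite /p; lia.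
suff : (Q ^+ m.+1)^-1 * r ^+ p.+2 <= expR (- u r) - expR (- a m) by lra.
apply: H => t /[!in_itv] /= /andP[t0 tr].
have t00 : 0 < t <= t by rewrite t0 lexx.
have := average_le_pow k (cl m) (lev t m (leqnn m) (ltW t0)) t00.
rewrite lerNr => /(ler_wpM2l (ltW t0)) /(ler_wpM2l (expR_ge0 (- u t))).
rewrite mulrN => /(le_trans _); apply.
have eu : expR (- u t) * expR (u t) = 1 by rewrite -expRD addNr expR0.
have -> : expR (- u t) * (t * (expR (u t) / Q ^+ m / (k.+1 + 2 * m)%:R * t ^+ (2 * m)))
   = (expR (- u t) * expR (u t)) * (Q ^+ m)^-1 * (k.+1 + 2 * m)%:R^-1 * t ^+ p.+1.
  rewrite exprS /p; ring.
rewrite eu mul1r mulrA ler_wpM2r ?exprn_ge0 ?(ltW t0) //.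
rewrite exprSr invfM -mulrA ler_wpM2l ?invr_ge0 ?exprn_ge0 ?(ltW Q0) //.
rewrite mulrC ler_pdivrMr // mulrC ler_pdivlMr ?ltr0n; last lia.
rewrite -natrM ler_nat /p.
apply: leq_mul; lia.
Qed.

End Comparison.

(** * Smoothness on open sets and the global solution *)

Lemma near_eq_differentiable {R : realFieldType} {V W : normedModType R}
    (f g : V -> W) (x : V) :
  {near x, f =1 g} -> differentiable f x -> differentiable g x.
Proof.
move=> fg df.
have fgx := nbhs_singleton fg.
have E : g \o shift x = cst (g x) + ('d f x : V -> W) +o_ 0 id.
  have /diff_locallyP[_ /eqaddoP Hf] := df.
  apply/eqaddoP => e e0.
  have := Hf e e0.
  have : \forall y \near (0 : V), f (y + x) = g (y + x).
    by move: fg; rewrite (near_shift 0) subr0.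
  apply: filterS2 => y fgy; rewrite !fctE /= fgy /cst /=.
  by rewrite fgx.
have c0 : continuous ('d f x) by exact: diff_continuous.
have D := diff_unique c0 E.
by apply/diff_locallyP; rewrite D; split.
Qed.

Section SmoothOn.
Context {R : realType} {N : nat}.
Implicit Types (x y : 'rV[R]_N) (f g : 'rV[R]_N -> R) (A : set 'rV[R]_N).

Lemma partial_ext A f g i x : open A -> A x -> (forall y, A y -> f y = g y) ->
  partial i f x = partial i g x.
Proof.
move=> oA Ax fg; apply: near_eq_derive.
by apply: filterS (open_nbhs_nbhs (conj oA Ax)) => y Ay; exact: fg.
Qed.

Lemma foldr_partial_ext A f g s x : open A -> A x ->
  (forall y, A y -> f y = g y) -> foldr partial f s x = foldr partial g s x.
Proof.
move=> oA + fg; elim: s x => [|i s IH] x Ax /=; first exact: fg.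
exact: (@partial_ext A).
Qed.

Lemma smooth_on_ext A f g : open A -> (forall y, A y -> f y = g y) ->
  smooth_on A f -> smooth_on A g.
Proof.
move=> oA fg sf s x Ax; apply: near_eq_differentiable (sf s x Ax).
apply: filterS (open_nbhs_nbhs (conj oA Ax)) => y Ay.
exact: (@foldr_partial_ext A).
Qed.

Lemma smooth_on_diff A f x : smooth_on A f -> A x -> differentiable f x.
Proof. by move=> sf; exact: sf [::] x. Qed.

Lemma smooth_on_deriv A f x i : smooth_on A f -> A x ->
  is_derive x (delta_mx ord0 i) f (partial i f x).
Proof. by move=> sf Ax; apply/derivableP/diff_derivable/(smooth_on_diff sf). Qed.

Lemma smooth_on_partial A f i : smooth_on A f -> smooth_on A (partial i f).
Proof. by move=> sf s x Ax; have := sf (rcons s i) x Ax; rewrite foldr_rcons. Qed.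

Lemma smooth_on_cst A (c : R) : smooth_on A (fun=> c).
Proof.
move=> s x _.
have [d ->] : exists d : R, foldr partial (fun=> c) s = fun=> d.
  elim: s => [|i s [d IH]]; first by exists c.
  exists 0; rewrite /= IH; apply/funext => y.
  by apply: is_derive_partial; exact: (is_derive_cst d).
exact: differentiable_cst.
Qed.

Lemma smooth_on_add A f g : open A -> smooth_on A f -> smooth_on A g ->
  smooth_on A (fun x => f x + g x).
Proof.
move=> oA sf sg s.
have E y : A y -> foldr partial (fun x => f x + g x) s y =
    foldr partial f s y + foldr partial g s y.
  elim: s y => [|i s IH] y Ay //=.
  rewrite (partial_ext i oA Ay IH).
  apply: is_derive_partial; apply: is_derive_add;
    apply/derivableP/diff_derivable; [exact: sf|exact: sg].
move=> x Ax.
apply: (@near_eq_differentiable _ _ _ (fun y =>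
  foldr partial f s y + foldr partial g s y)).
  by apply: filterS (open_nbhs_nbhs (conj oA Ax)) => y Ay; rewrite E.
by apply: differentiableD; [exact: sf|exact: sg].
Qed.

Lemma smooth_on_sum A (I : Type) (r : seq I) (F : I -> 'rV[R]_N -> R) : open A ->
  (forall i, smooth_on A (F i)) -> smooth_on A (fun x => \sum_(i <- r) F i x).
Proof.
move=> oA sF; elim: r => [|i r IH].
  apply: (@smooth_on_ext A (fun=> 0) _ oA); last exact: smooth_on_cst.
  by move=> y _; rewrite big_nil.
apply: (@smooth_on_ext A (fun y => F i y + \sum_(j <- r) F j y) _ oA).
  by move=> y _; rewrite big_cons.
exact: smooth_on_add.
Qed.

Lemma smooth_on_laplacian A f : open A -> smooth_on A f -> smooth_on A (laplacian f).
Proof.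
by move=> oA sf; apply: smooth_on_sum => // i; do 2 apply: smooth_on_partial.
Qed.

Lemma smooth_on_iter_laplacian A f j : open A -> smooth_on A f ->
  smooth_on A (iter j laplacian f).
Proof. by move=> oA sf; elim: j => //= j IH; exact: smooth_on_laplacian. Qed.

Lemma laplacian_ext A f g x : open A -> A x -> (forall y, A y -> f y = g y) ->
  laplacian f x = laplacian g x.
Proof.
move=> oA Ax fg; apply: eq_bigr => i _.
by apply: (partial_ext i oA Ax) => y Ay; exact: (partial_ext i oA Ay).
Qed.

Lemma laplacian_scale A f (c : R) x : open A -> A x -> smooth_on A f ->
  laplacian (fun y => c * f y) x = c * laplacian f x.
Proof.
move=> oA Ax sf; rewrite /laplacian mulr_sumr; apply: eq_bigr => i _.
rewrite (@partial_ext A _ (fun y => c * partial i f y) i x oA Ax).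
  apply: is_derive_partial; apply: is_derive_scale; apply: (smooth_on_deriv i _ Ax).
  exact: smooth_on_partial.
move=> y Ay; apply: is_derive_partial; apply: is_derive_scale.
exact: (smooth_on_deriv i sf Ay).
Qed.

Lemma neg_laplacian_iterE A f j x : open A -> A x -> smooth_on A f ->
  neg_laplacian_iter j f x = (-1) ^+ j * iter j laplacian f x.
Proof.
move=> oA + sf; elim: j x => [|j IH] x Ax; first by rewrite expr0 mul1r.
rewrite /neg_laplacian_iter /= -/(neg_laplacian_iter j f).
rewrite (laplacian_ext oA Ax IH) (laplacian_scale _ oA Ax);
  last exact: smooth_on_iter_laplacian.
by rewrite exprS mulN1r mulNr.
Qed.

End SmoothOn.

Section Existence.
Context {R : realType}.

(** The sign [(-1)^m = -1] turns the source [- e^u] of the cascade into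
    the right-hand side [e^u]. *)
Lemma picard_radial_solution k (b : nat -> R) m (a : 'I_m.+1 -> R) u :
  (forall j : 'I_m.+1, b (m - j)%N = a j) -> odd m.+1 ->
  continuous u -> picard_map k b m.+1 u = u ->
  radial_solution k.+1 a +oo%E u.
Proof.
move=> ba om cu Pu; have nu := sq_diff_picard cu Pu.
pose G r := - expR (u r).
have nG : sq_diff 1 G.
  rewrite (_ : G = fun r => (-1) * expR (u r)).
    by apply: sq_diff_mul; [exact: sq_diff_cst|exact: sq_diff_expR].
  by apply/funext => r; rewrite mulN1r.
have lapE j : (j <= m.+1)%N -> iter j laplacian (radial u : 'rV[R]_k.+1 -> R) =
    radial (tower k b G (m.+1 - j)).
  by move=> jm; rewrite -{1}Pu; exact: iter_laplacian_tower.
split.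
- by rewrite ltry.
- by move=> ?; exact: radial_smooth.
- move=> x _.
  have sT : smooth_on setT (radial u : 'rV[R]_k.+1 -> R) by exact: radial_smooth.
  rewrite (neg_laplacian_iterE _ openT) // lapE // subnn /= /radial /G.
  by rewrite -signr_odd om expr1 mulN1r opprK.
- by move=> j _; exact: derive1n_odd0.
- move=> j; rewrite lapE; last exact/ltnW/ltn_ord.
  rewrite subSn; last by rewrite -ltnS ltn_ord.
  by rewrite /radial /= enorm0 inverse_laplacian0 ba.
Qed.

End Existence.

(** * Uniqueness *)

Section Uniqueness.
Context {R : realType}.

Lemma line_deriv {N : nat} (h : 'rV[R]_N -> R) (e : 'rV[R]_N) (r d : R) :
  is_derive (r *: e) e h d -> is_derive r 1 (fun t => h (t *: e)) d.
Proof.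
have E : (fun s : R => s^-1 *: (((fun t => h (t *: e)) \o shift r) (s *: 1) - h
  (r *: e)))
   = (fun s : R => s^-1 *: ((h \o shift (r *: e)) (s *: e) - h (r *: e))).
  by apply/funext => s /=; rewrite [s *: 1]mulr1 scalerDl.
move=> [dv <-]; split; first by rewrite /derivable E.
by rewrite /derive E.
Qed.

Lemma enorm_continuous {N : nat} : continuous (@enorm R N).
Proof.
move=> x; apply: continuous_comp; last exact: sqrt_continuous.
exact/differentiable_continuous/sqn_diff.
Qed.

Lemma open_enorm_lt {N : nat} (rho : \bar R) :
  open [set x : 'rV[R]_N | (enorm x)%:E < rho]%E.
Proof.
rewrite (_ : [set x | _] = @enorm R N @^-1` [set r | r%:E < rho]%E) //.
apply: open_comp; first by move=> x _; exact: enorm_continuous.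
case: rho => [r| |].
- by rewrite (_ : [set _ | _] = [set x | x < r]); [exact: open_lt|apply/seteqP; split].
- by rewrite (_ : [set _ | _] = setT); [exact: openT|apply/seteqP;
    split=> // x _ /=; rewrite ltry].
- by rewrite (_ : [set _ | _] = set0); [exact: open0|apply/seteqP; split].
Qed.

Section Competitor.
Variables (k : nat) (rho : \bar R) (v : R -> R).
Hypothesis k_gt0 : (0 < k)%N.
Let A := [set x : 'rV[R]_k.+1 | (enorm x)%:E < rho]%E.
Hypothesis smv : smooth_on A (radial v).
Let e0 : 'rV[R]_k.+1 := delta_mx ord0 ord0.
Let w j : 'rV[R]_k.+1 -> R := iter j laplacian (radial v).
Let phi j (r : R) := w j (r *: e0).
Let psi j (r : R) := partial ord0 (w j) (r *: e0).
Let chi j (r : R) := partial ord0 (partial ord0 (w j)) (r *: e0).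

Let oA : open A. Proof. exact: open_enorm_lt. Qed.

Let sw j : smooth_on A (w j).
Proof. exact: smooth_on_iter_laplacian. Qed.

Lemma enorm_axis (r : R) : enorm (r *: e0) = `|r|.
Proof.
rewrite /enorm (bigD1 ord0) //= big1.
  by rewrite !mxE /= mulr1 addr0 sqrtr_sqr.
by move=> i i0; rewrite !mxE /= (negPf i0) mulr0 expr0n.
Qed.

Let Aaxis (r : R) : 0 <= r -> (r%:E < rho)%E -> A (r *: e0).
Proof. by move=> r0 rr; rewrite /A /= enorm_axis ger0_norm. Qed.

Let dphi j (r : R) : 0 <= r -> (r%:E < rho)%E -> is_derive r 1 (phi j) (psi j r).
Proof.
move=> r0 rr; apply: line_deriv.
exact: (smooth_on_deriv ord0 (sw j) (Aaxis r0 rr)).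
Qed.

Let dpsi j (r : R) : 0 <= r -> (r%:E < rho)%E -> is_derive r 1 (psi j) (chi j r).
Proof.
move=> r0 rr; apply: line_deriv.
exact: (smooth_on_deriv ord0 (smooth_on_partial ord0 (sw j)) (Aaxis r0 rr)).
Qed.

Let g j (r : R) := psi j r / r.
Let q j (r : R) := (r * chi j r - psi j r) / r ^+ 3.

Let dphig j (r : R) : 0 < r -> (r%:E < rho)%E -> is_derive r 1 (phi j) (r * g j r).
Proof.
move=> r0 rr; apply: is_derive_eq (dphi j (ltW r0) rr) _.
by rewrite /g mulrC divfK // gt_eqF.
Qed.

Let dg j (r : R) : 0 < r -> (r%:E < rho)%E -> is_derive r 1 (g j) (r * q j r).
Proof.
move=> r0 rr; have rn0 : r != 0 by rewrite gt_eqF.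
have d := is_derive_mul (dpsi j (ltW r0) rr)
  (@is_deriveV R (fun y : R => y) r _ 1 rn0 (is_derive_id1 r)).
apply: is_derive_eq d _; rewrite /q /GRing.scale /=.
by field.
Qed.

Let w_radial_and_eq j :
  (forall x, A x -> x != 0 -> w j x = phi j (enorm x)) /\
  (forall r : R, 0 < r -> (r%:E < rho)%E ->
     phi j.+1 r = k.+1%:R * g j r + r ^+ 2 * q j r).
Proof.
have step j' : (forall x, A x -> x != 0 -> w j' x = phi j' (enorm x)) ->
   forall x, A x -> x != 0 ->
     w j'.+1 x = k.+1%:R * g j' (enorm x) + enorm x ^+ 2 * q j' (enorm x).
  move=> H x Ax x0.
  have oB : open (A `&` [set y | y != 0]).
    apply: openI => //; rewrite (_ : [set y | y != 0] = ~` [set 0]).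
      exact/closed_openC/accessible_closed_set1/hausdorff_accessible/norm_hausdorff.
    by apply/seteqP; split=> y /= /eqP.
  rewrite /w /= -/(w j') (@laplacian_ext _ _ _ _ (radial (phi j')) x oB).
  - apply: laplacian_radial_at => //; last first.
      by apply: dg Ax; exact: enorm_gt0.
    apply: filterS (open_nbhs_nbhs (conj oB (conj Ax x0))) => y [Ay y0].
    by apply: dphig Ay; exact: enorm_gt0.
  - by split.
  - by move=> y [Ay y0]; exact: H.
have H j' : forall x, A x -> x != 0 -> w j' x = phi j' (enorm x).
  elim: j' => [|j' IH] x Ax x0.
    by rewrite /phi /w /= /radial enorm_axis ger0_norm // enorm_ge0.
  rewrite (step _ IH) // /phi (step _ IH).
  - by rewrite enorm_axis ger0_norm // enorm_ge0.
  - by apply: Aaxis Ax; exact: enorm_ge0.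
  - have := enorm_gt0 x0; apply: contraTneq => /(congr1 (@enorm R _)).
    by rewrite enorm_axis enorm0 => /normr0_eq0 ->; rewrite ltxx.
split=> [|r r0 rr]; first exact: H.
have re0 : r *: e0 != 0.
  have := r0; apply: contraTneq => /(congr1 (@enorm R _)).
  by rewrite enorm_axis enorm0 => /normr0_eq0 ->; rewrite ltxx.
have := step j (H j) _ (Aaxis (ltW r0) rr) re0.
by rewrite enorm_axis gtr0_norm.
Qed.

(** The iterated Laplacians of a radial function are radial away from the
    origin, by induction from [laplacian_radial_at]; on the positive half-axis
    they therefore satisfy the flux equations of the cascade.  For [k > 0] the
    flux [r^(k+1) (psi / r) = r^k psi] is continuous up to [r = 0]. *)
Lemma competitor_flux j (b : R) : (b%:E < rho)%E ->
  [/\ {within `[0, b], continuous (phi j)},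
      {within `[0, b], continuous (fun r => r ^+ k.+1 * g j r)},
      (forall r : R, 0 < r < b -> is_derive r 1 (phi j) (r * g j r)) &
      (forall r : R, 0 < r < b ->
         is_derive r 1 (fun r => r ^+ k.+1 * g j r) (r ^+ k * phi j.+1 r))].
Proof.
move=> brho.
have lt_rho (r : R) : r <= b -> (r%:E < rho)%E.
  by move=> rb; apply: le_lt_trans brho; rewrite lee_fin.
split.
- apply: within_cont => r /andP[r0 rb].
  exact: is_derive_cont (dphi j r0 (lt_rho _ rb)).
- rewrite (_ : (fun r => _) = fun r : R => r ^+ k * psi j r).
    apply: within_cont => r /andP[r0 rb].
    apply: is_derive_cont (is_derive_mul (is_derive_X k r) (dpsi j r0 (lt_rho _ rb))).
  apply/funext => r; rewrite /g; have [->|r0] := eqVneq r 0.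
    by rewrite !expr0n /= eqn0Ngt k_gt0 !mul0r.
  by rewrite exprS; field.
- by move=> r /andP[r0 rb]; apply: dphig => //; exact/lt_rho/ltW.
- move=> r /andP[r0 rb]; have rr := lt_rho _ (ltW rb).
  apply: is_derive_eq (is_derive_mul (is_derive_X k.+1 r) (dg j r0 rr)) _.
  rewrite ((w_radial_and_eq j).2 r r0 rr) /= !exprS; ring.
Qed.

End Competitor.

(** On a compact interval both solutions are bounded, so the
    difference of the two sources is controlled by the difference [d 0] of the
    solutions.  Passing [m] times through [flux_exp_bound] improves a bound
    [K exp(l r^2)] on [d 0] to half of it; iterating gives [d 0 = 0]. *)
Lemma radial_solution_unique k (b : nat -> R) m (a : 'I_m.+1 -> R) u rho v :
  (0 < k)%N -> (forall j : 'I_m.+1, b (m - j)%N = a j) -> odd m.+1 ->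
  continuous u -> picard_map k b m.+1 u = u ->
  radial_solution k.+1 a rho v ->
  forall r : R, 0 <= r -> (r%:E < rho)%E -> v r = u r.
Proof.
move=> k0 ba om cu Pu [_ sv eqv _ iv] c c0 crho.
pose e0 : 'rV[R]_k.+1 := delta_mx ord0 ord0.
pose w j : 'rV[R]_k.+1 -> R := iter j laplacian (radial v).
pose phi j (r : R) := w j (r *: e0).
pose G r := - expR (u r).
have cG : continuous G by exact: expN_cont.
pose U j := tower k b G (m.+1 - j).
pose g j (r : R) := partial ord0 (w j) (r *: e0) / r.
have cU j : continuous (U j) by exact: tower_cont.
have flux j := @competitor_flux k rho v k0 sv j c crho.
pose d j (r : R) := phi j r - U j r.
pose vv j (r : R) := g j r - average k (U j.+1) r.
have US j : (j <= m)%N -> U j = inverse_laplacian k (b (m - j)%N) (U j.+1).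
  by move=> jm; rewrite /U subSS subSn.
have d0 j : (j <= m)%N -> d j 0 = 0.
  move=> jm; rewrite /d US // inverse_laplacian0 /phi scale0r /w.
  have jm' : (j < m.+1)%N by [].
  by rewrite (iv (Ordinal jm')) (ba (Ordinal jm')) subrr.
have phi0 r : 0 <= r -> phi 0%N r = v r.
  by move=> r0; rewrite /phi /w /= /radial enorm_axis ger0_norm.
have U0 r : U 0%N r = u r by rewrite /U subn0 -[in RHS]Pu.
have [cphi _ _ _] := flux 0%N.
have [B HB] : exists B, forall r, 0 <= r <= c -> phi 0%N r <= B /\ u r <= B.
  have [x1 _ H1] := EVT_max c0 cphi.
  have [x2 _ H2] := EVT_max c0 (continuous_subspaceT cu).
  exists (Num.max (phi 0%N x1) (u x2)) => r rc.
  by rewrite !le_max H1 ?H2 ?in_itv //= orbT.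
have [M M0 HM] : exists2 M, 0 <= M & forall r, 0 <= r <= c -> `|d 0%N r| <= M.
  have cd : {within `[0, c], continuous (fun r => `|d 0%N r|)}.
    move=> x; apply: cvg_norm; apply: cvgB; first exact: cphi.
    exact: (continuous_subspaceT (cU 0%N)).
  have [x1 _ H1] := EVT_max c0 cd.
  by exists `|d 0%N x1| => // r rc; apply: H1; rewrite in_itv.
pose L := expR B; pose Q := 2 * L + 1.
have L0 : 0 < L by exact: expR_gt0.
pose l := Q / (2 * k.+1%:R).
have k0' : (0 : R) < k.+1%:R by rewrite ltr0n.
have Q1 : 1 <= Q by rewrite /Q; lra.
have Q0 : 0 < Q by lra.
have l0 : 0 < l by rewrite /l divr_gt0 ?mulr_gt0 //; lra.
have lQ : 2 * l * k.+1%:R = Q.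
  by rewrite /l; field; rewrite addrC natr1 pnatr_eq0.
have Qm : Q <= Q ^+ m.+1 by rewrite exprS ler_peMr ?exprn_ege1 //; lra.
(* One round through the cascade halves the weighted bound. *)
have step K : 0 <= K ->
   (forall r : R, 0 <= r <= c -> `|d 0%N r| <= K * expR (l * r ^+ 2)) ->
   forall r : R, 0 <= r <= c -> `|d 0%N r| <= K / 2 * expR (l * r ^+ 2).
  move=> K0 HK.
  have lev i : (i <= m.+1)%N -> forall r : R, 0 <= r <= c ->
     `|d (m.+1 - i)%N r| <= L * K / Q ^+ i * expR (l * r ^+ 2).
    elim: i => [_|i IH im] r rc.
      rewrite subn0 expr0 divr1.
      have /andP[r0 rc'] := rc.
      have -> : d m.+1 r = - (expR (phi 0%N r) - expR (u r)).
        rewrite /d /U subnn /= /G opprK.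
        have Ar : ((enorm (r *: e0))%:E < rho)%E.
          rewrite enorm_axis ger0_norm //; apply: le_lt_trans crho.
          by rewrite lee_fin.
        have := eqv _ Ar.
        rewrite (neg_laplacian_iterE m.+1 (@open_enorm_lt k.+1 rho) Ar sv).
        rewrite -signr_odd om expr1 mulN1r -/(w m.+1) -/(phi m.+1 r) => E.
        by rewrite -[phi m.+1 r]opprK E /phi /w /= opprB addrC.
      rewrite normrN; have [B1 B2] := HB r rc.
      apply: (le_trans (expR_lipschitz B1 B2)).
      rewrite -/L -mulrA (ler_wpM2l (ltW L0)) //.
      by have := HK r rc; rewrite /d U0.
    have jm : (m.+1 - i.+1 <= m)%N by rewrite subSS leq_subr.
    have jS : (m.+1 - i.+1).+1 = (m.+1 - i)%N by rewrite subSS subSn.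
    set j := (m.+1 - i.+1)%N in jm jS *.
    have [c1 c2 d1 d2] := flux j.
    suff : `|d j r - d j 0| <= L * K / Q ^+ i / (2 * l * k.+1%:R) * expR (l * r ^+ 2).
      by rewrite lQ d0 // subr0 (exprSr Q i) invfM [L * K * (_ * _)]mulrA.
    apply: (@flux_exp_bound R k c (d j) (vv j) (d j.+1) (L * K / Q ^+ i) l l0 _
      _ _ _ _ _ r rc).
    - by rewrite divr_ge0 ?exprn_ge0 ?mulr_ge0 // ltW.
    - move=> x; apply: cvgB; first exact: c1.
      exact: (continuous_subspaceT (cU j)).
    - rewrite (_ : (fun r => _) = fun r : R => r ^+ k.+1 * g j r -
         r ^+ k.+1 * average k (U j.+1) r).
        move=> x; apply: cvgB; first exact: c2.
        have ca := deriv_cont (fun y => average_pow_deriv k y (cU j.+1)).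
        exact: (continuous_subspaceT ca).
      by apply/funext => x; rewrite mulrBr.
    - move=> x xc; apply: is_derive_eq (is_derive_sub (d1 x xc) _) _.
        rewrite US //; exact: inverse_laplacian_deriv.
      by rewrite /vv mulrBr.
    - move=> x xc.
      rewrite (_ : (fun r => _) = fun r : R => r ^+ k.+1 * g j r -
         r ^+ k.+1 * average k (U j.+1) r); last first.
        by apply/funext => y; rewrite mulrBr.
      apply: is_derive_eq (is_derive_sub (d2 x xc) (average_pow_deriv k x (cU j.+1))) _.
      by rewrite /d mulrBr.
    - move=> x /andP[x0 xc]; rewrite jS; apply: IH; first exact: ltnW.
      by rewrite !ltW.
  move=> r rc; have := lev m.+1 (leqnn _) r rc; rewrite subnn => /le_trans; apply.
  rewrite ler_wpM2r ?expR_ge0 // [L * K]mulrC -mulrA ler_wpM2l //.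
  rewrite ler_pdivrMr; last exact: lt_le_trans Qm.
  rewrite /Q in Qm *; lra.
have all_n n : forall r : R, 0 <= r <= c ->
    `|d 0%N r| <= M * 2^-1 ^+ n * expR (l * r ^+ 2).
  elim: n => [|n IH] r rc.
    rewrite expr0 mulr1; apply: (le_trans (HM r rc)).
    by rewrite ler_peMr // -expR0 ler_expR mulr_ge0 ?(ltW l0) // sqr_ge0.
  rewrite exprSr mulrA; apply: step => //.
  by rewrite mulr_ge0 // exprn_ge0 // invr_ge0.
have cc : 0 <= c <= c by rewrite c0 lexx.
have : `|d 0%N c| <= 0.
  apply: (@le0_geometric _ _ (M * expR (l * c ^+ 2))) => n.
  by rewrite mulrAC; exact: all_n.
by rewrite normr_le0 /d U0 phi0 // subr_eq0 => /eqP.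
Qed.

End Uniqueness.

(** * Integration over tuples *)

Section IntegrationRn.
Context {R : realType}.
Local Notation mR := (measurableTypeR R).

Definition row_of n (t : n.-tuple mR) : 'rV[R]_n := \row_i (tnth t i : R).

Definition row_cons n (x : R) (y : 'rV[R]_n) : 'rV[R]_n.+1 :=
  \row_i (if unlift ord0 i is Some j then y ord0 j else x).

Lemma row_of_cons n (p : mR * n.-tuple mR) :
  row_of (tuple_cons p) = row_cons p.1 (row_of p.2).
Proof.
apply/rowP => i; rewrite !mxE; case: unliftP => [j ->|->].
  by rewrite mxE tnthS.
by rewrite tnth0.
Qed.

Lemma row_cons0 n (x : R) (y : 'rV[R]_n) : row_cons x y ord0 ord0 = x.
Proof. by rewrite mxE unlift_none. Qed.

Lemma row_consS n (x : R) (y : 'rV[R]_n) j : row_cons x y ord0 (lift ord0 j) = y ord0 j.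
Proof. by rewrite mxE liftK. Qed.

Lemma norm_le_coord n (y : 'rV[R]_n) (M : R) : 0 <= M ->
  (forall i, `|y ord0 i| <= M) -> `|y| <= M.
Proof.
move=> M0 H; rewrite [leLHS]/Num.Def.normr /= mx_normrE.
by apply: bigmax_le => // -[i j] _ /=; rewrite ord1.
Qed.

Lemma row_cons_ge_head n (x : R) (y : 'rV[R]_n) : `|x| <= `|row_cons x y|.
Proof. by rewrite -{1}(row_cons0 x y) coord_le_norm. Qed.

Lemma row_cons_ge_tail n (x : R) (y : 'rV[R]_n) : `|y| <= `|row_cons x y|.
Proof.
by apply: norm_le_coord => // i; rewrite -(row_consS x y) coord_le_norm.
Qed.

Lemma row_consB n (x x' : R) (y y' : 'rV[R]_n) :
  row_cons x y - row_cons x' y' = row_cons (x - x') (y - y').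
Proof. by apply/rowP => i; rewrite !mxE; case: unlift => // j; rewrite !mxE. Qed.

Lemma row_cons_le n (x : R) (y : 'rV[R]_n) (M : R) : `|x| <= M -> `|y| <= M ->
  `|row_cons x y| <= M.
Proof.
move=> xM yM; apply: norm_le_coord; first exact: le_trans xM.
move=> i; rewrite mxE; case: unlift => [j|//].
exact: le_trans (coord_le_norm _ _) yM.
Qed.

Lemma lipschitz1_cont (V W : normedModType R) (f : V -> W) :
  (forall x y, `|f x - f y| <= `|x - y|) -> continuous f.
Proof.
move=> H x; apply/cvgrPdist_lt => e e0.
have : \forall y \near x, ball x e y by exact: nbhsx_ballx.
by apply: filterS => y; rewrite -ball_normE /=; exact: le_lt_trans.
Qed.

Lemma row_cons_cont_tail n (x : R) : continuous (@row_cons n x).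
Proof.
apply: lipschitz1_cont => y y'; rewrite row_consB subrr.
by apply: row_cons_le => //; rewrite normr0.
Qed.

Lemma row_cons_cont_head n (y : 'rV[R]_n) : continuous (fun x : R => row_cons x y).
Proof.
apply: lipschitz1_cont => x x'; rewrite row_consB subrr.
by apply: row_cons_le => //; rewrite normr0.
Qed.

(** Open sets are countable unions of boxes with rational centres and sizes,
    and boxes are measurable for the product sigma-algebra. *)
Lemma row_of_open n (U : set 'rV[R]_n) : open U ->
  measurable [set t : n.-tuple mR | U (row_of t)].
Proof.
move=> oU.
pose box (c : 'rV[rat]_n * rat) : set 'rV[R]_n :=
  [set y | forall i, `|y ord0 i - ratr (c.1 ord0 i)| < ratr c.2].
pose F c := if `[< box c `<=` U >] then [set t : n.-tuple mR | box c (row_of t)]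
  else set0.
have -> : [set t : n.-tuple mR | U (row_of t)] = \bigcup_c F c.
  apply/seteqP; split => t /=; last first.
    by move=> [c _]; rewrite /F; case: ifPn => // /asboolP cU /cU.
  move=> Ut; set x := row_of t in Ut *.
  have /nbhs_ballP [e /= e0 He] : nbhs x U by exact: open_nbhs_nbhs.
  have [d /itvP de] := rat_in_itvoo e0.
  have d0 : (0 : R) < ratr d / 2 by rewrite divr_gt0 // de.
  have near_q i : exists q : rat, `|x ord0 i - ratr q| < ratr d / 2.
    have [q] : exists q : rat, (ratr q : R) \in `](x ord0 i - ratr d / 2), (x
      ord0 i + ratr d / 2)[.
      by apply: rat_in_itvoo; lra.
    rewrite in_itv /= => /andP[q1 q2]; exists q; rewrite ltr_norml; lra.
  pose c := (\row_i sval (cid (near_q i)), d / 2).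
  have Hc i : `|x ord0 i - ratr (c.1 ord0 i)| < ratr c.2.
    have -> : c.1 ord0 i = sval (cid (near_q i)) by rewrite /c /= mxE.
    by rewrite /c /= fmorph_div /= ratr_nat; case: cid.
  exists c => //; rewrite /F ifT //; apply/asboolP => y Hy.
  apply: He; rewrite -ball_normE /=.
  have xy i : `|(x - y) ord0 i| <= ratr d.
    have := ltrD (Hc i) (Hy i); rewrite fmorph_div /= ratr_nat -splitr [`|y _ _
      - _|]distrC.
    move/ltW; apply: le_trans; apply: le_trans (ler_normD _ _).
    have -> : (x - y) ord0 i = x ord0 i - y ord0 i by rewrite [LHS]mxE [(- y) _ _]mxE.
    by rewrite addrA subrK.
  apply: le_lt_trans (norm_le_coord _ xy) _; last by rewrite de.
  by rewrite ltW // de.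
apply: countable_bigcupT_measurable; first exact: countableP.
move=> c; rewrite /F; case: ifPn => // _.
have -> : [set t : n.-tuple mR | box c (row_of t)] =
  \bigcap_(i in [set: 'I_n]) ((fun t : n.-tuple mR => tnth t i) @^-1`
     (ball (ratr (c.1 ord0 i) : R) (ratr c.2))).
  apply/seteqP; split => t /= H i; have := H i.
    by rewrite /row_of mxE /ball /= distrC.
  by rewrite /row_of mxE /ball /= distrC; apply.
apply: fin_bigcap_measurable => // i _.
rewrite ball_itv -[X in measurable X]setTI.
exact: (@measurable_tnth _ mR n i measurableT _ (measurable_itv _)).
Qed.

Lemma row_of_measurable n (h : 'rV[R]_n -> R) : continuous h ->
  measurable_fun setT (fun t : n.-tuple mR => h (row_of t)).
Proof.
move=> ch; apply: (measurability _ (RGenOpens.measurableE R)).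
move=> _ [_ [a [b ->] <-]]; rewrite setTI.
have oU : open (h @^-1` `]a, b[%classic).
  by apply: open_comp => [x _|]; [exact: ch|exact: interval_open].
exact: row_of_open oU.
Qed.

Lemma box_measurable n (M : R) : measurable [set t : n.-tuple mR | `|row_of t| <= M].
Proof.
have -> : [set t : n.-tuple mR | `|row_of t| <= M] =
    ~` [set t | [set y : 'rV[R]_n | M < `|y|] (row_of t)].
  by apply/seteqP; split => t /=; rewrite leNgt => /negP.
apply: measurableC; apply: row_of_open.
rewrite (_ : [set y | _] = (fun y : 'rV[R]_n => `|y|) @^-1` [set x | M < x]) //.
by apply: open_comp; [move=> y _; exact: norm_continuous|exact: open_gt].
Qed.

(** The box is a product of segments, by induction on the dimension. *)
Lemma box_finite n (M : R) : 0 <= M ->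
  (lebesgue_Rn n [set t : n.-tuple mR | (`|row_of t| <= M)%R] < +oo)%E.
Proof.
move=> M0; elim: n => [|n IH].
  by rewrite /= /dirac; apply: (@le_lt_trans _ _ 1%:E);
    rewrite ?ltry // lee_fin indicE; case: (_ \in _).
pose B k := [set t : k.-tuple mR | `|row_of t| <= M].
rewrite /= /lebesgue_cons /pushforward.
have E : @tuple_cons R n @^-1` B n.+1 = `[- M, M]%classic `*` B n.
  apply/seteqP; split => -[x t]; rewrite /B /= row_of_cons /= in_itv /= -ler_norml.
    move=> H; split; first exact: le_trans (row_cons_ge_head _ _) H.
    exact: le_trans (row_cons_ge_tail _ _) H.
  by move=> [xM tM]; exact: row_cons_le.
rewrite [X in (_ X < _)%E]E product_measure1E //; last exact: box_measurable.
apply: lte_mul_pinfty => //.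
suff : lebesgue_measure `[- M, M]%classic \is a fin_num by [].
by rewrite lebesgue_measure_itv /=; case: ifP.
Qed.

Definition bounded_support n (h : 'rV[R]_n -> R) (M : R) := forall y, M < `|y|
  -> h y = 0.

Lemma bounded_support_integrable n (h : 'rV[R]_n -> R) (M : R) : 0 <= M ->
  continuous h -> bounded_support h M ->
  (lebesgue_Rn n).-integrable setT (fun t => (h (row_of t))%:E).
Proof.
move=> M0 ch hM; pose B := [set t : n.-tuple mR | `|row_of t| <= M].
have mB : measurable B by exact: box_measurable.
pose f (t : n.-tuple mR) := h (row_of t).
have fB : ((EFin \o f) \_ B) = (fun t => (h (row_of t))%:E).
  apply/funext => t; rewrite patchE; case: ifPn => // tB.
  by rewrite hM // ltNge; apply: contraNN tB => tM; rewrite inE.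
rewrite -fB; apply/(integrable_mkcond _ mB).
apply: measurable_bounded_integrable => //; first exact: box_finite.
  exact: measurable_funS (row_of_measurable ch).
pose K := [set y : 'rV[R]_n | `|y| <= M].
have cK : compact K.
  apply: bounded_closed_compact.
    by exists M; split; [exact: num_real|move=> x Mx y /= yM;
      exact: le_trans yM (ltW Mx)].
  rewrite (_ : K = (fun y : 'rV[R]_n => `|y|) @^-1` [set x | x <= M]) //.
  by apply: closed_comp; [move=> y _; exact: norm_continuous|exact: closed_le].
have K0 : K !=set0 by exists 0; rewrite /K /= normr0.
have [|c _ Hc] := @EVT_max_rV R n (fun y => `|h y|) K K0 cK.
  apply: continuous_subspaceT => y; apply: (@continuous_comp _ _ _ h (fun z : R
    => `|z|)).
    exact: ch.
  exact: norm_continuous.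
exists `|h c|; split; first exact: num_real.
move=> x cx t Bt; apply: le_trans (ltW cx); apply: Hc.
by rewrite inE.
Qed.

Lemma tuple_cons_integrable n (h : 'rV[R]_n.+1 -> R) (M : R) : 0 <= M ->
  continuous h -> bounded_support h M ->
  (lebesgue_measure \x lebesgue_Rn n)%E.-integrable setT
     (fun p : mR * n.-tuple mR => (h (row_cons p.1 (row_of p.2)))%:E).
Proof.
move=> M0 ch hM.
have := bounded_support_integrable M0 ch hM.
have mh := row_of_measurable ch.
move=> /integrableP[_ Hi]; apply/integrableP; split.
  apply/measurable_EFinP.
  rewrite (_ : (fun p => _) = (fun t : n.+1.-tuple mR =>
    h (row_of t)) \o @tuple_cons R n).
    by apply: measurableT_comp => //; exact: measurable_tuple_cons.
  by apply/funext => p /=; rewrite row_of_cons.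
move: Hi; rewrite /= /lebesgue_cons ge0_integral_pushforward //; last first.
  by apply/measurable_EFinP; exact: measurableT_comp.
  exact: measurable_tuple_cons.
rewrite preimage_setT; apply: le_lt_trans; rewrite le_eqVlt; apply/orP; left; apply/eqP.
  by apply: eq_integral => p _ /=; rewrite row_of_cons.
Qed.

Lemma integral_tuple_cons n (h : 'rV[R]_n.+1 -> R) (M : R) : 0 <= M ->
  continuous h -> bounded_support h M ->
  (\int[lebesgue_Rn n.+1]_t (h (row_of t))%:E =
  \int[lebesgue_measure \x lebesgue_Rn n]_p (h (row_cons p.1 (row_of p.2)))%:E)%E.
Proof.
move=> M0 ch hM; rewrite /= /lebesgue_cons integral_pushforward //.
- by apply: eq_integral => p _ /=; rewrite row_of_cons.
- exact: measurable_tuple_cons.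
- by apply/measurable_EFinP; exact: row_of_measurable.
- rewrite preimage_setT (_ : _ \o _ = (fun p : mR * n.-tuple mR =>
    (h (row_cons p.1 (row_of p.2)))%:E)).
    exact: tuple_cons_integrable hM.
  by apply/funext => p /=; rewrite row_of_cons.
Qed.

(** Fundamental theorem of calculus on a segment containing the support. *)
Lemma integral_deriv1 (f df : R -> R) (M : R) : 0 <= M ->
  (forall x : R, is_derive x 1 f (df x)) -> continuous df ->
  (forall x : R, M < `|x| -> f x = 0) -> (forall x : R, M < `|x| -> df x = 0) ->
  (\int[lebesgue_measure]_x (df x)%:E = 0)%E.
Proof.
move=> M0 d_f cdf fM dfM.
(* A segment strictly larger than the support, so that [f] vanishes at both
   ends. *)
pose a : R := M + 1.
have a0 : - a < a by rewrite /a; lra.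
have -> : (\int[lebesgue_measure]_x (df x)%:E = \int[lebesgue_measure]_(x in
  `[(- a)%R, a]) (df x)%:E)%E.
  rewrite [RHS]integral_mkcond; apply: eq_integral => x _; rewrite patchE.
  case: ifPn => // xa; rewrite dfM // ltNge; apply: contraNN xa => xM.
  by rewrite inE /= in_itv /= -ler_norml (le_trans xM) // /a lerDl.
have cf : continuous f by exact: deriv_cont.
rewrite (@continuous_FTC2 _ df f) //.
- have Ma : M < `|a| by rewrite ger0_norm /a; lra.
  by rewrite -EFinB !fM ?normrN // subrr.
- exact: continuous_subspaceT.
- split.
  + by move=> x _; case: (d_f x).
  + by apply: cvg_at_right_filter; exact: cf.
  + by apply: cvg_at_left_filter; exact: cf.
- by move=> x _; rewrite derive1E derive_val.
Qed.

Lemma row_cons_deriv_head n (h : 'rV[R]_n.+1 -> R) (x : R) (y : 'rV[R]_n) (d : R) :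
  is_derive (row_cons x y) (delta_mx ord0 ord0) h d ->
  is_derive x 1 (fun t => h (row_cons t y)) d.
Proof.
have E : (fun s : R => s^-1 *: (((fun t => h (row_cons t y)) \o shift x) (s *:
  1) - h (row_cons x y)))
   = (fun s : R => s^-1 *: ((h \o shift (row_cons x y)) (s *: delta_mx ord0
     ord0) - h (row_cons x y))).
  apply/funext => s /=; congr (_ *: (h _ - _)).
  apply/rowP => i; rewrite !mxE; case: unliftP => [j ->|->].
    by rewrite mulr0 add0r.
  by rewrite mulr1 [s *: 1]mulr1.
move=> [dv <-]; split; first by rewrite /derivable E.
by rewrite /derive E.
Qed.

Lemma row_cons_deriv_tail n (h : 'rV[R]_n.+1 -> R) (x : R) (y : 'rV[R]_n) j (d : R) :
  is_derive (row_cons x y) (delta_mx ord0 (lift ord0 j)) h d ->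
  is_derive y (delta_mx ord0 j) (fun z => h (row_cons x z)) d.
Proof.
have E : (fun s : R => s^-1 *: (((fun z => h (row_cons x z)) \o shift y) (s *:
  delta_mx ord0 j) - h (row_cons x y)))
   = (fun s : R => s^-1 *: ((h \o shift (row_cons x y)) (s *: delta_mx ord0
     (lift ord0 j)) - h (row_cons x y))).
  apply/funext => s /=; congr (_ *: (h _ - _)).
  apply/rowP => i; rewrite !mxE; case: unliftP => [i' ->|->].
    by rewrite !mxE /= (inj_eq lift_inj).
  by rewrite (negPf (neq_lift _ _)) andbF mulr0 add0r.
move=> [dv <-]; split; first by rewrite /derivable E.
by rewrite /derive E.
Qed.

(** By Fubini, the first variable or the remaining ones are integrated
    first, according to whether the derivative is taken along the first axis
    or along another one. *)
Lemma integral_partial n (h dh : 'rV[R]_n -> R) i (M : R) : 0 <= M ->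
  (forall y, is_derive y (delta_mx ord0 i) h (dh y)) ->
  continuous h -> continuous dh -> bounded_support h M -> bounded_support dh M ->
  (\int[lebesgue_Rn n]_t (dh (row_of t))%:E = 0)%E.
Proof.
move=> M0; elim: n i h dh => [[] //|n IH] i h dh d_h ch cdh hM dhM.
rewrite (integral_tuple_cons M0 cdh dhM).
have ti := tuple_cons_integrable M0 cdh dhM.
case: (unliftP ord0 i) => [j ij|i0].
  rewrite -integral12_prod_meas1 // /fubini_F /=.
  rewrite integral0_eq // => x _.
  apply: (IH j (fun z => h (row_cons x z)) (fun z => dh (row_cons x z))).
  - by move=> y; apply: row_cons_deriv_tail; rewrite -ij; exact: d_h.
  - by move=> y; apply: continuous_comp; [exact: row_cons_cont_tail|exact: ch].
  - by move=> y; apply: continuous_comp; [exact: row_cons_cont_tail|exact: cdh].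
  - by move=> y yM; apply: hM; exact: lt_le_trans yM (row_cons_ge_tail _ _).
  - by move=> y yM; apply: dhM; exact: lt_le_trans yM (row_cons_ge_tail _ _).
rewrite -integral21_prod_meas1 // /fubini_G /=.
rewrite integral0_eq // => t _.
apply: (@integral_deriv1 (fun x => h (row_cons x (row_of t))) (fun x =>
  dh (row_cons x (row_of t))) M).
- by [].
- by move=> x; apply: row_cons_deriv_head; rewrite -i0; exact: d_h.
- by move=> x; apply: (@continuous_comp _ _ _ (fun x : R => row_cons x (row_of t)) dh);
    [exact: row_cons_cont_head|exact: cdh].
- by move=> x xM; apply: hM; exact: lt_le_trans xM (row_cons_ge_head _ _).
- by move=> x xM; apply: dhM; exact: lt_le_trans xM (row_cons_ge_head _ _).
Qed.

End IntegrationRn.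

(** * Weighted Hardy and Rellich inequalities *)

Section ContinuousFunctions.
Context {R : realType} {T : topologicalType}.
Implicit Types (h g : T -> R).

Lemma cont_mul h g : continuous h -> continuous g -> continuous (fun x => h x * g x).
Proof. by move=> ch cg x; exact: (continuousM (ch x) (cg x)). Qed.

Lemma cont_add h g : continuous h -> continuous g -> continuous (fun x => h x + g x).
Proof. by move=> ch cg x; exact: (continuousD (ch x) (cg x)). Qed.

Lemma cont_opp h : continuous h -> continuous (fun x => - h x).
Proof. by move=> ch x; exact: (continuousN (ch x)). Qed.

Lemma cont_cst (c : R) : continuous (fun _ : T => c).
Proof. exact: cst_continuous. Qed.

Lemma cont_pow h k : continuous h -> continuous (fun x => h x ^+ k).
Proof.
by move=> ch x; apply: (@continuous_comp _ _ _ h (fun r : R => r ^+ k));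
  [exact: ch|exact: cont_X].
Qed.

End ContinuousFunctions.

Ltac continuity := repeat first [done | exact: cont_cst | apply: cont_mul |
  apply: cont_add | apply: cont_opp | apply: cont_pow].

Section HardyRellich.
Context {R : realType} {N : nat}.
Implicit Types (x : 'rV[R]_N) (f g h : 'rV[R]_N -> R).

Definition cont_csupp h := continuous h /\ exists2 M : R, 0 <= M & bounded_support h M.

Lemma cc_mul h g : cont_csupp h -> continuous g -> cont_csupp (fun x => h x * g x).
Proof.
move=> [ch [M M0 hM]] cg; split.
  exact: cont_mul.
by exists M => // x xM; rewrite hM // mul0r.
Qed.

Lemma cc_scale (c : R) h : cont_csupp h -> cont_csupp (fun x => c * h x).
Proof.
move=> ch; rewrite (_ : (fun x => _) = fun x => h x * cst c x).
  by apply: cc_mul => //; exact: cst_continuous.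
by apply/funext => x; rewrite mulrC.
Qed.

Lemma cc_sq h : cont_csupp h -> cont_csupp (fun x => h x ^+ 2).
Proof.
move=> ch; rewrite (_ : (fun x => _) = fun x => h x * h x).
  exact: cc_mul ch.1.
by apply/funext => x; rewrite expr2.
Qed.

Lemma cc_add h g : cont_csupp h -> cont_csupp g -> cont_csupp (fun x => h x + g x).
Proof.
move=> [ch [M M0 hM]] [cg [M' M0' gM]]; split.
  exact: cont_add.
exists (Num.max M M'); first by rewrite le_max M0.
by move=> x; rewrite gt_max => /andP[xM xM']; rewrite hM // gM // addr0.
Qed.

Lemma cc_sum (I : Type) (r : seq I) (F : I -> 'rV[R]_N -> R) :
  (forall i, cont_csupp (F i)) -> cont_csupp (fun x => \sum_(i <- r) F i x).
Proof.
move=> cF; elim: r => [|i r IH].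
  rewrite (_ : (fun x => _) = cst 0); last by apply/funext => x; rewrite big_nil.
  split; first exact: cst_continuous.
  by exists 0.
rewrite (_ : (fun x => _) = fun x => F i x + \sum_(j <- r) F j x).
  exact: cc_add.
by apply/funext => x; rewrite big_cons.
Qed.

Lemma cc_integrable h : cont_csupp h ->
  (lebesgue_Rn N).-integrable setT (EFin \o (fun t => h (\row_i (tnth t i : R)))).
Proof. by move=> [ch [M M0 hM]]; exact: (bounded_support_integrable M0 ch hM). Qed.

Lemma integral_le h g : cont_csupp h -> cont_csupp g ->
  (forall x, h x <= g x) -> integral_Rn h <= integral_Rn g.
Proof.
by move=> ch cg hg; apply: le_Rintegral => //; exact: cc_integrable.
Qed.

Lemma integral_add h g : cont_csupp h -> cont_csupp g ->
  integral_Rn (fun x => h x + g x) = integral_Rn h + integral_Rn g.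
Proof. by move=> ch cg; rewrite /integral_Rn RintegralD //; exact: cc_integrable. Qed.

Lemma integral_scale (c : R) h : cont_csupp h ->
  integral_Rn (fun x => c * h x) = c * integral_Rn h.
Proof. by move=> ch; rewrite /integral_Rn RintegralZl //; exact: cc_integrable. Qed.

Lemma integral_sum0 (I : Type) (r : seq I) (F : I -> 'rV[R]_N -> R) :
  (forall i, cont_csupp (F i)) -> (forall i, integral_Rn (F i) = 0) ->
  integral_Rn (fun x => \sum_(i <- r) F i x) = 0.
Proof.
move=> cF F0; elim: r => [|i r IH].
  rewrite (_ : (fun x => _) = fun x => 0 * \sum_(j <- [::]) F j x).
    by rewrite integral_scale ?mul0r //; exact: cc_sum.
  by apply/funext => x; rewrite big_nil mul0r.
rewrite (_ : (fun x => _) = fun x => F i x + \sum_(j <- r) F j x).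
  by rewrite integral_add ?F0 ?IH ?addr0 //; exact: cc_sum.
by apply/funext => x; rewrite big_cons.
Qed.

(** Fields with compact support, so there is no boundary term. *)
Lemma divergence_theorem (W dW : 'I_N -> 'rV[R]_N -> R) :
  (forall i, cont_csupp (W i)) -> (forall i, cont_csupp (dW i)) ->
  (forall i x, is_derive x (delta_mx ord0 i) (W i) (dW i x)) ->
  integral_Rn (fun x => \sum_i dW i x) = 0.
Proof.
move=> cW cdW dWE; apply: integral_sum0 => // i.
have [cw [M M0 wM]] := cW i; have [cdw [M' M0' dwM]] := cdW i.
rewrite /integral_Rn /Rintegral.
have := @integral_partial R N (W i) (dW i) i (Num.max M M') _ (dWE i) cw cdw.
rewrite /row_of => -> //; first by rewrite le_max M0.
- by move=> y; rewrite gt_max => /andP[yM _]; exact: wM.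
- by move=> y; rewrite gt_max => /andP[_ yM]; exact: dwM.
Qed.

(** The integral inequalities of Hardy and Rellich type hold pointwise up to
    a divergence. *)
Lemma integral_le_div f g (W dW : 'I_N -> 'rV[R]_N -> R) :
  cont_csupp f -> cont_csupp g ->
  (forall i, cont_csupp (W i)) -> (forall i, cont_csupp (dW i)) ->
  (forall i x, is_derive x (delta_mx ord0 i) (W i) (dW i x)) ->
  (forall x, f x <= g x + \sum_i dW i x) ->
  integral_Rn f <= integral_Rn g.
Proof.
move=> cf cg cW cdW dWE H.
rewrite -[leRHS]addr0 -(divergence_theorem cW cdW dWE) -integral_add //;
  last exact: cc_sum.
by apply: integral_le => //; apply: cc_add => //; exact: cc_sum.
Qed.

(** The support condition of [test_function] in terms of a radius, which is
    the same for all partial derivatives. *)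
Definition test_like f :=
  smooth_on setT f /\ exists2 M : R, 0 <= M & bounded_support f M.

Lemma test_function_like f : test_function f -> test_like f.
Proof.
move=> [sf /compact_bounded [M [Mr HM]]]; split => //.
exists (`|M| + 1); first by rewrite addr_ge0.
move=> x; apply: contraTeq => fx; rewrite -leNgt.
apply: HM; last exact: subset_closure.
by apply: le_lt_trans (ler_norm M) _; rewrite ltrDl.
Qed.

Lemma test_like_deriv f x i : test_like f ->
  is_derive x (delta_mx ord0 i) f (partial i f x).
Proof. by move=> [sf _]; exact: (smooth_on_deriv i sf). Qed.

Lemma test_like_cc f : test_like f -> cont_csupp f.
Proof.
move=> [sf H]; split => // x.
exact/differentiable_continuous/(smooth_on_diff sf).
Qed.

Lemma test_like_partial f i : test_like f -> test_like (partial i f).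
Proof.
move=> [sf [M M0 fM]]; split; first exact: smooth_on_partial.
exists M => // x xM.
have oU : open [set y : 'rV[R]_N | M < `|y|].
  rewrite (_ : [set y | _] = (fun y : 'rV[R]_N => `|y|) @^-1` [set x | M < x]) //.
  by apply: open_comp; [move=> y _; exact: norm_continuous|exact: open_gt].
rewrite (@partial_ext _ _ _ f (cst 0) i x oU xM fM).
by apply: is_derive_partial; exact: is_derive_cst.
Qed.

Lemma test_like_laplacian f : test_like f -> test_like (laplacian f).
Proof.
move=> tf; split.
  by case: tf => sf _; exact: smooth_on_laplacian openT sf.
suff [_ H] : cont_csupp (laplacian f) by [].
by apply: cc_sum => i; apply: test_like_cc; do 2 apply: test_like_partial.
Qed.

Lemma test_like_iter f j : test_like f -> test_like (iter j laplacian f).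
Proof. by move=> tf; elim: j => //= j IH; exact: test_like_laplacian. Qed.

Section Weight.
Variable e : R.
Hypothesis e_gt0 : 0 < e.

(** The shift by [e] removes the singularity of [|x|^(-2)] at the origin, so
    that no cut-off is needed; its powers play the role of [|x|^(-2k)]. *)
Definition weight x : R := (sqn x + e)^-1.

Lemma weight_gt0 x : 0 < weight x.
Proof. by rewrite invr_gt0 ltr_wpDl // sqn_ge0. Qed.

Lemma weight_sqn x : sqn x * weight x <= 1.
Proof. by rewrite ler_pdivrMr ?mul1r ?lerDl ?ltW // ltr_wpDl // sqn_ge0. Qed.

Lemma weight_deriv x i :
  is_derive x (delta_mx ord0 i) weight (- (2 * x ord0 i * weight x ^+ 2)).
Proof.
have s0 : sqn x + e != 0 by rewrite gt_eqF // ltr_wpDl // sqn_ge0.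
have d1 : is_derive (sqn x) 1 (fun s : R => s + e) 1.
  by rewrite -[X in is_derive _ _ _ X]addr0; apply: is_derive_add.
have d2 := @is_deriveV R (fun s : R => s + e) (sqn x) _ 1 s0 d1.
have d := is_derive_comp d2 (sqn_diff x) (sqn_deriv x i).
apply: is_derive_eq d _; rewrite /weight /GRing.scale /= exprVn; ring.
Qed.

Lemma weight_pow_deriv k x i :
  is_derive x (delta_mx ord0 i) (fun y => weight y ^+ k)
    (- (2 * k%:R * x ord0 i * weight x ^+ k.+1)).
Proof.
apply: is_derive_eq (is_derive_pow k (weight_deriv x i)) _.
case: k => [|k] /=; first by rewrite !(mul0r, mulr0) oppr0.
by rewrite !exprS; ring.
Qed.

Lemma weight_cont k : continuous (fun x => weight x ^+ k).
Proof.
move=> x; apply: (@continuous_comp _ _ _ weight (fun r : R => r ^+ k));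
  last exact: cont_X.
apply: (@continuous_comp _ _ _ sqn (fun s : R => (s + e)^-1)).
  exact/differentiable_continuous/sqn_diff.
have s0 : sqn x + e != 0 by rewrite gt_eqF // ltr_wpDl // sqn_ge0.
apply: cvgV => //; apply: cvgD; [exact: cvg_id|exact: cvg_cst].
Qed.

Lemma coord_cont i : continuous (fun x : 'rV[R]_N => x ord0 i).
Proof. by move=> x; exact/differentiable_continuous/coord_diff. Qed.

Lemma gradient_sq f x : enorm (gradient f x) ^+ 2 = \sum_i partial i f x ^+ 2.
Proof. by rewrite enorm_sq /sqn; apply: eq_bigr => i _; rewrite mxE. Qed.

(** Completing the square in [|grad f + c weight f x|^2], up to the divergence
    of the field [c f^2 weight x]. *)
Lemma hardy f (c : R) : test_like f -> 0 <= c -> 2 * c <= N%:R - 2 ->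
  integral_Rn (fun x => c ^+ 2 * (f x ^+ 2 * weight x)) <=
  integral_Rn (fun x => enorm (gradient f x) ^+ 2).
Proof.
move=> tf c0 cN.
have cf := test_like_cc tf.
have cp i := test_like_cc (test_like_partial i tf).
have [ccf _] := cf.
have cw j : continuous (fun x => weight x ^+ j) by exact: weight_cont.
have cw1 : continuous weight by have := cw 1%N.
pose W i x := c * (f x * (f x * (x ord0 i * weight x ^+ 1))).
pose dW i x := c * (f x * (2 * partial i f x * (x ord0 i * weight x) +
   f x * (weight x - 2 * x ord0 i ^+ 2 * weight x ^+ 2))).
have cx := coord_cont.
have cgp i := (cp i).1.
apply: (@integral_le_div _ _ W dW).
- by apply: cc_scale; apply: cc_mul => //; exact: cc_sq.
- rewrite (_ : (fun x => _) = fun x => \sum_i partial i f x ^+ 2).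
    by apply: cc_sum => i; exact: cc_sq.
  by apply/funext => x; rewrite gradient_sq.
- by move=> i; apply: cc_scale; apply: cc_mul => //; continuity.
- by move=> i; apply: cc_scale; apply: cc_mul => //; continuity.
- move=> i x.
  have df := test_like_deriv x i tf.
  have dd := is_derive_scale c (is_derive_mul df (is_derive_mul df
    (is_derive_mul (coord_deriv x i i) (weight_pow_deriv 1 x i)))).
  apply: is_derive_eq dd _; rewrite /= eqxx /dW expr1.
  have -> : true%:R = 1 :> R by [].
  ring.
- move=> x; rewrite gradient_sq /dW -mulr_sumr -mulr_sumr.
  set G := \sum_i _ ^+ 2; set w := weight x.
  have w0 : 0 < w by exact: weight_gt0.
  pose S := \sum_i (x ord0 i * partial i f x).
  have E : \sum_i (2 * partial i f x * (x ord0 i * w) + f x * (w - 2 * x ord0 i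
    ^+ 2 * w ^+ 2))
     = 2 * w * S + f x * (N%:R * w - 2 * w ^+ 2 * sqn x).
    rewrite big_split /= -mulr_sumr sumrB /= sumr_const card_ord /S /sqn -[w *+
      N]mulr_natl.
    rewrite !mulr_sumr; congr (_ + _ * (_ - _)); apply: eq_bigr => i _; ring.
  rewrite E.
  have sq : 0 <= G + 2 * c * w * f x * S + c ^+ 2 * w ^+ 2 * f x ^+ 2 * sqn x.
    have -> : G + 2 * c * w * f x * S + c ^+ 2 * w ^+ 2 * f x ^+ 2 * sqn x =
       \sum_i (partial i f x + c * w * f x * x ord0 i) ^+ 2.
      rewrite /G /S /sqn !mulr_sumr -!big_split /=; apply: eq_bigr => i _; ring.
    by apply: sumr_ge0 => i _; exact: sqr_ge0.
  have ws : sqn x * w <= 1 by exact: weight_sqn.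
  set s := sqn x in sq ws *; set p := f x in sq *.
  have P : 0 <= (p ^+ 2 * w) * (c * (N%:R - 2 * (s * w)) - c ^+ 2 * (1 + s * w)).
    apply: mulr_ge0; first by rewrite mulr_ge0 ?sqr_ge0 // ltW.
    have : 0 <= c * ((N%:R - 2 - 2 * c) + (2 + c) * (1 - s * w)).
      by apply: mulr_ge0 => //; apply: addr_ge0; [lra|apply: mulr_ge0; lra].
    by move/le_trans; apply; rewrite le_eqVlt; apply/orP; left; apply/eqP; ring.
  rewrite -subr_ge0.
  have -> : G + c * (p * (2 * w * S + p * (N%:R * w - 2 * w ^+ 2 * s))) - c ^+ 2
    * (p ^+ 2 * w)
    = (G + 2 * c * w * p * S + c ^+ 2 * w ^+ 2 * p ^+ 2 * s) +
      (p ^+ 2 * w) * (c * (N%:R - 2 * (s * w)) - c ^+ 2 * (1 + s * w)) by ring.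
  exact: addr_ge0.
Qed.

(** Completing the square in [(laplacian f + c weight f)^2], with weight
    [weight^k], up to the divergence of
    [2 c (weight^(k+1) f grad f - f^2 grad (weight^(k+1)) / 2)].  The term in
    [|grad f|^2] has a good sign and is dropped: this loses a factor of order
    [N^2], which the decay of the potential leaves room for. *)
Lemma rellich f (c : R) k : test_like f -> 0 <= c -> c <= N%:R - 2 * k.+2%:R ->
  integral_Rn (fun x => c ^+ 2 * (f x ^+ 2 * weight x ^+ k.+2)) <=
  integral_Rn (fun x => laplacian f x ^+ 2 * weight x ^+ k).
Proof.
move=> tf c0 cN.
have cf := test_like_cc tf.
have tp i := test_like_partial i tf.
have cp i := test_like_cc (tp i).
have cpp i := test_like_cc (test_like_partial i (tp i)).
have cl := test_like_cc (test_like_laplacian tf).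
have [ccf _] := cf.
have cw j : continuous (fun x => weight x ^+ j) by exact: weight_cont.
pose q : R := k.+1%:R.
pose W i x := 2 * c * (f x * (partial i f x * weight x ^+ k.+1 +
   q * (x ord0 i * (f x * weight x ^+ k.+2)))).
pose dW i x := 2 * c * (partial i f x * (partial i f x * weight x ^+ k.+1) +
   (f x * (partial i (partial i f) x * weight x ^+ k.+1) +
   f x * (f x * (q * weight x ^+ k.+2 - 2 * q * (q + 1) * (x ord0 i ^+ 2 *
     weight x ^+ k.+3))))).
have cx := coord_cont.
have cgp i := (cp i).1.
have cgpp i := (cpp i).1.
have cgl := cl.1.
apply: (@integral_le_div _ _ W dW).
- by apply: cc_scale; apply: cc_mul => //; exact: cc_sq.
- by apply: cc_mul => //; exact: cc_sq.
- by move=> i; apply: cc_scale; apply: cc_mul => //; continuity.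
- move=> i; apply: cc_scale; apply: cc_add; first by apply: cc_mul => //; continuity.
  apply: cc_add; first by apply: cc_mul => //; continuity.
  by apply: cc_mul => //; continuity.
- move=> i x.
  have df := test_like_deriv x i tf.
  have ddf := test_like_deriv x i (tp i).
  have dd := is_derive_scale (2 * c) (is_derive_mul df (is_derive_add
    (is_derive_mul ddf (weight_pow_deriv k.+1 x i))
    (is_derive_scale q (is_derive_mul (coord_deriv x i i)
       (is_derive_mul df (weight_pow_deriv k.+2 x i)))))).
  apply: is_derive_eq dd _; rewrite /= eqxx /dW.
  have -> : k.+2%:R = q + 1 :> R by rewrite /q -natr1.
  have -> : true%:R = 1 :> R by [].
  by rewrite -/q !exprS; ring.
- move=> x; rewrite /dW -mulr_sumr.
  set w := weight x.
  have w0 : 0 < w by exact: weight_gt0.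
  pose G := \sum_i partial i f x ^+ 2.
  have E : \sum_i (partial i f x * (partial i f x * w ^+ k.+1) +
     (f x * (partial i (partial i f) x * w ^+ k.+1) +
     f x * (f x * (q * w ^+ k.+2 - 2 * q * (q + 1) * (x ord0 i ^+ 2 * w ^+ k.+3)))))
     = w ^+ k.+1 * G + (f x * w ^+ k.+1 * laplacian f x +
        f x ^+ 2 * (N%:R * (q * w ^+ k.+2) - 2 * q * (q + 1) * w ^+ k.+3 * sqn x)).
    rewrite !big_split /= /G /laplacian /sqn !mulr_sumr.
    congr (_ + (_ + _)); [apply: eq_bigr => i _; ring|apply: eq_bigr => i _; ring|].
    rewrite -!mulr_sumr mulrA -expr2 sumrB sumr_const card_ord -[_ *+ N]mulr_natl.
    by congr (_ * (_ - _)); rewrite mulr_sumr; apply: eq_bigr => i _; ring.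
  rewrite E.
  set L := laplacian f x; set p := f x; set s := sqn x.
  have G0 : 0 <= G by apply: sumr_ge0 => i _; exact: sqr_ge0.
  have ws : s * w <= 1 by exact: weight_sqn.
  have wk : 0 <= w ^+ k by rewrite exprn_ge0 // ltW.
  have q1 : 1 <= q by rewrite /q ler1n.
  have qk : k.+2%:R = q + 1 :> R by rewrite /q -natr1.
  rewrite qk in cN.
  have P1 : 0 <= w ^+ k * (L + c * (p * w)) ^+ 2 by rewrite mulr_ge0 // sqr_ge0.
  have P2 : 0 <= 2 * c * (w * w ^+ k * G) by rewrite !mulr_ge0 // ltW.
  (* This is where the condition [c <= N - 2 (k + 2)] enters: the weight is
     superharmonic up to the required margin. *)
have P3 : 0 <= 2 * c * (w ^+ k * (p * w) ^+ 2) * (q * N%:R - 2 * q * (q + 1) *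
  (s * w) - c).
    apply: mulr_ge0.
      by apply: mulr_ge0; [exact: mulr_ge0|apply: mulr_ge0 => //; exact: sqr_ge0].
    have H1 : 0 <= 2 * q * (q + 1) * (1 - s * w).
      by apply: mulr_ge0; [apply: mulr_ge0; lra|lra].
    have H2 : 0 <= (q - 1) * c by apply: mulr_ge0 => //; lra.
    have H3 : 0 <= q * (N%:R - 2 * (q + 1) - c) by apply: mulr_ge0; lra.
    by move: (addr_ge0 H1 (addr_ge0 H2 H3)) => /le_trans; apply;
      rewrite le_eqVlt; apply/orP; left; apply/eqP; ring.
  rewrite -subr_ge0.
  have -> : L ^+ 2 * w ^+ k + 2 * c * (w ^+ k.+1 * G + (p * w ^+ k.+1 * L +
      p ^+ 2 * (N%:R * (q * w ^+ k.+2) - 2 * q * (q + 1) * w ^+ k.+3 * s))) -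
      c ^+ 2 * (p ^+ 2 * w ^+ k.+2) =
      w ^+ k * (L + c * (p * w)) ^+ 2 + 2 * c * (w * w ^+ k * G) +
      2 * c * (w ^+ k * (p * w) ^+ 2) * (q * N%:R - 2 * q * (q + 1) * (s * w) - c).
    rewrite !exprS; ring.
  by rewrite !addr_ge0.
Qed.

(** Hardy once, then Rellich [j] times. *)
Lemma hardy_rellich f (c : R) j : test_like f -> 0 <= c ->
  2 * c <= N%:R - 2 -> c <= N%:R - 2 * (2 * j).+1%:R ->
  c ^+ (2 * j).+2 * integral_Rn (fun x => f x ^+ 2 * weight x ^+ (2 * j).+1) <=
  integral_Rn (fun x => enorm (gradient (iter j laplacian f) x) ^+ 2).
Proof.
move=> tf c0 cN.
have cc k g : test_like g -> cont_csupp (fun x => g x ^+ 2 * weight x ^+ k).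
  move=> tg; have cg := test_like_cc tg; apply: cc_mul; last exact: weight_cont.
  exact: cc_sq.
have main i : (i <= j)%N -> c <= N%:R - 2 * (2 * j).+1%:R ->
  c ^+ (2 * i).+2 * integral_Rn (fun x => iter (j - i) laplacian f x ^+ 2 *
    weight x ^+ (2 * i).+1) <=
  integral_Rn (fun x => enorm (gradient (iter j laplacian f) x) ^+ 2).
  move=> + cj; elim: i => [_|i IH ij].
    rewrite muln0 subn0; have tl := test_like_iter j tf.
    rewrite -integral_scale; last exact: cc.
    exact: hardy.
  apply: le_trans (IH (ltnW ij)).
  have -> : ((2 * i.+1).+2 = (2 * i).+2 + 2)%N by lia.
  have -> : ((2 * i.+1).+1 = (2 * i).+3)%N by lia.
  rewrite exprD -mulrA ler_wpM2l ?exprn_ge0 //.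
  have -> : (j - i = (j - i.+1).+1)%N by lia.
  have tl := test_like_iter (j - i.+1) tf.
  rewrite -integral_scale; last exact: cc.
  apply: rellich => //; apply: le_trans cj _.
  rewrite lerD2l lerN2 ler_pM2l // ler_nat; lia.
by move=> /(main j (leqnn j)); rewrite subnn.
Qed.

End Weight.
End HardyRellich.

(** * Stability *)

Section Stability.
Context {R : realType}.

Lemma exprD_le (s e : R) m : 0 <= s -> 0 <= e ->
  (s + e) ^+ m <= 2 ^+ m * (s ^+ m + e ^+ m).
Proof.
move=> s0 e0; have [se|es] := leP s e.
  apply: (@le_trans _ _ ((2 * e) ^+ m)).
    by apply: lerXn2r; rewrite ?nnegrE ?addr_ge0 ?mulr_ge0 //; lra.
  by rewrite exprMn ler_wpM2l ?exprn_ge0 // lerDr exprn_ge0.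
apply: (@le_trans _ _ ((2 * s) ^+ m)).
  by apply: lerXn2r; rewrite ?nnegrE ?addr_ge0 ?mulr_ge0 //; lra.
by rewrite exprMn ler_wpM2l ?exprn_ge0 // lerDl exprn_ge0.
Qed.

(** The lower bound for [exp (- v)], in which [s] stands for [|x|^2], is
    turned into a bound for [exp v] by a power of the weight.  The shift [e]
    is chosen so that [e^(m+1) / Q^(m+1)] is [exp (- a0)]. *)
Lemma growth_weight (Q a0 : R) m : 0 < Q ->
  exists2 e, 0 < e & forall s v : R, 0 <= s ->
    expR (- a0) + s ^+ m.+1 / Q ^+ m.+1 <= expR (- v) ->
    expR v <= (2 * Q) ^+ m.+1 * (s + e)^-1 ^+ m.+1.
Proof.
move=> Q0; exists (Q * expR (- a0 / m.+1%:R)); first by rewrite mulr_gt0 ?expR_gt0.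
set e := Q * _; have e0 : 0 < e by rewrite mulr_gt0 ?expR_gt0.
have em : e ^+ m.+1 = Q ^+ m.+1 * expR (- a0).
  by rewrite exprMn -expRM_natl mulrC [_%:R * _]mulrC divfK ?pnatr_eq0 // mulrC.
move=> s v s0 H.
have Qm : 0 < Q ^+ m.+1 by rewrite exprn_gt0.
have se : 0 < (s + e) ^+ m.+1 by rewrite exprn_gt0 // ltr_wpDl.
rewrite exprVn ler_pdivlMr //.
apply: le_trans (ler_wpM2l (expR_ge0 v) (exprD_le m.+1 s0 (ltW e0))) _.
rewrite em exprMn [leLHS]mulrCA ler_wpM2l ?exprn_ge0 //.
have E : s ^+ m.+1 + Q ^+ m.+1 * expR (- a0) =
    Q ^+ m.+1 * (expR (- a0) + s ^+ m.+1 / Q ^+ m.+1).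
  by rewrite mulrDr [_ * (_ / _)]mulrC divfK ?gt_eqF // addrC.
rewrite E mulrCA -[leRHS]mulr1 ler_wpM2l ?(ltW Qm) //.
apply: le_trans (ler_wpM2l (expR_ge0 v) H) _.
by rewrite -expRD subrr expR0.
Qed.

(** With [c = N / 4], the left-hand side is at most [(32 m c)^m], so that one
    more factor [c >= (32 m)^m] is enough. *)
Lemma dimension_large m N : (0 < m)%N -> (4 * (32 * m) ^ m <= N)%N ->
  [/\ (4 * m <= N)%N, (4 <= N)%N & 
  (2 * (2 * m * (N + 2 * m))%:R) ^+ m <= (N%:R / 4) ^+ m.+1 :> R].
Proof.
move=> m0 hN.
have h1 : (32 * m <= (32 * m) ^ m)%N.
  by rewrite -{1}[(32 * m)%N]expn1 leq_pexp2l // muln_gt0.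
have h2 : (4 * (32 * m) <= N)%N by apply: leq_trans hN; rewrite leq_mul2l h1 orbT.
split; [lia|lia|].
have N0 : (0 : R) <= N%:R / 4 by rewrite divr_ge0.
apply: (@le_trans _ _ (((32 * m)%:R * (N%:R / 4)) ^+ m)).
  apply: lerXn2r; rewrite ?nnegrE ?mulr_ge0 //.
  have -> : (32 * m)%:R * (N%:R / 4) = (8 * m * N)%:R :> R.
    by rewrite !natrM; field.
  by rewrite -natrM ler_nat; nia.
rewrite exprMn exprS ler_wpM2r ?exprn_ge0 // ler_pdivlMr //.
by rewrite -natrX -natrM ler_nat mulnC.
Qed.

(** The decay hypothesis bounds [exp u] by [(2 Q)^m] times a power of a weight,
    and the quadratic form controls [(N / 4)^(m+1)] times the integral of
    [phi^2] against the same power; the last hypothesis compares the two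
    constants. *)
Lemma radial_stable k j u (Q a0 : R) : let m := (2 * j).+1 in
  0 < Q -> (forall n, sq_diff n u) ->
  (forall r : R, 0 <= r -> expR (- a0) + r ^+ (2 * m) / Q ^+ m <= expR (- u r)) ->
  2 * (k.+1%:R / 4) <= k.+1%:R - 2 :> R ->
  k.+1%:R / 4 <= k.+1%:R - 2 * m%:R :> R ->
  (2 * Q) ^+ m <= (k.+1%:R / 4) ^+ m.+1 ->
  stable m (radial u : 'rV[R]_k.+1 -> R).
Proof.
move=> m Q0 nu gu c1 c2 c3 phi tphi.
have tl := test_function_like tphi.
have -> : (m.-1)./2 = j by rewrite /m /= mul2n doubleK.
have [e e0 He] := growth_weight a0 (2 * j) Q0.
rewrite subr_ge0.
have cN : (0 : R) <= k.+1%:R / 4 by rewrite divr_ge0.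
apply: le_trans (hardy_rellich e0 tl cN c1 c2).
have cphi := test_like_cc tl.
have ccw : cont_csupp (fun x : 'rV[R]_k.+1 => phi x ^+ 2 * weight e x ^+ m).
  by apply: cc_mul; [exact: cc_sq|exact: weight_cont].
rewrite -integral_scale //; apply: integral_le.
- rewrite (_ : (fun x => _) = fun x => phi x ^+ 2 * expR (radial u x)); last first.
    by apply/funext => x; rewrite mulrC.
  apply: cc_mul; first exact: cc_sq.
  move=> x; apply: (@continuous_comp _ _ _ (radial u) expR);
    last exact: continuous_expR.
  apply: differentiable_continuous.
  have [g _ dg] := nu 1%N.
  exact: radial_diff dg x.
- rewrite (_ : (fun x => _) = fun x => (phi x ^+ 2 * weight e x ^+ m) * cst
    ((k.+1%:R / 4) ^+ m.+1) x).
    by apply: cc_mul => //; exact: cst_continuous.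
  by apply/funext => x; rewrite mulrC.
- move=> x; rewrite mulrC [leRHS]mulrCA ler_wpM2l ?sqr_ge0 //.
  have := gu (enorm x) (enorm_ge0 x); rewrite exprM enorm_sq => /(He _ _ (sqn_ge0 x)).
  move/le_trans; apply; rewrite ler_wpM2r // exprn_ge0 // ltW //; exact: weight_gt0.
Qed.

End Stability.

Theorem theorem1p2 (R : realType) (m : nat) (hm3 : (3 <= m)%N) (hmodd : odd m) :
  exists N0 : nat, forall (N : nat), (N0 <= N)%N ->
  forall a : 'I_m -> R, (forall k : 'I_m, (1 <= k)%N -> a k <= 0) ->
  exists (rho : \bar R) (u : R -> R),
    [/\ maximal_radial_solution N a rho u,
        rho = +oo%E &
        stable m (radial u : 'rV[R]_N -> R)].
Proof.
(* This threshold makes [N / 4] at least [(32 m)^m]. *)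
exists (4 * (32 * m) ^ m)%N => N hN a ha.
have m0 : (0 < m)%N by exact: leq_trans hm3.
have [N1 N4 hc] := @dimension_large R m N m0 hN.
have [j mj] : exists j, m = (2 * j).+1.
  exists m./2; have := odd_double_half m; rewrite hmodd; lia.
subst m; case: N hN N1 N4 hc => [//|k] hN N1 N4 hc.
(* The tower lists the values at the origin starting from the innermost
   inverse Laplacian, that is, in the reverse order of [a]. *)
pose b i := a (inord (2 * j - i)).
have ba (i : 'I_(2 * j).+1) : b (2 * j - i)%N = a i.
  rewrite /b subKn; last by rewrite -ltnS ltn_ord.
  by rewrite inord_val.
have b0 i : (i < 2 * j)%N -> b i <= 0.
  move=> ij; apply: ha; rewrite inordK; first by rewrite subn_gt0.
  by rewrite ltnS leq_subr.
have [u [cu _ Pu]] := picard_fixpoint k b0.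
exists +oo%E, u; split=> //.
- split; first exact: picard_radial_solution.
  move=> rho' v solv; split; first exact: leey.
  apply: radial_solution_unique ba hmodd cu Pu solv.
  by rewrite -ltnS; exact: leq_trans N4.
- have gu := picard_growth b0 cu Pu.
  apply: radial_stable (sq_diff_picard cu Pu) gu _ _ hc.
  + by rewrite ltr0n; lia.
  + have : (4 : R) <= k.+1%:R by rewrite (ler_nat _ 4).
    lra.
  + have : (4 * (2 * j).+1)%:R <= k.+1%:R :> R by rewrite ler_nat.
    rewrite natrM; have := ler0n R (2 * j).+1; lra.
Qed.
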